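(* Let $n,m\in\mathbb{N}$ and let $A_k\in\mathbb{R}^{n\times n}$, $B_k\in\mathbb{R}^{n\times m}$, $Q_k\in\mathbb{S}^n_+$, $R_k\in\mathbb{S}^m_{++}$ ($k\in\mathbb{N}_0$) be problem data such that: $\|A_k\|_2,\|B_k\|_2,\|Q_k\|_2,\|R_k\|_2$ are bounded uniformly in $k$; every $A_k$ is non-singular; there is $d\in\mathbb{N}$ such that for all $k\in\mathbb{N}_0$ the $d$-step controllability matrix $\mathcal{C}_{k,d}$ has full row rank and the $d$-step observability matrix $\mathcal{O}_{k,d}$ has full column rank; and, for the lifted data $(\tilde A_t,\tilde B_t,\tilde Q_t,\tilde R_t)_{t\in\mathbb{N}_0}$ constructed with this $d$, $\inf_{t}\lambda_{\min}(\tilde Q_t)>0$, $\inf_{t}\lambda_{\min}(\tilde B_t\tilde B_t')>0$, and $\inf_{t}\lambda_{\min}(\tilde A_t\tilde A_t')>0$. Let $\mathcal{R}_t$ be the Riccati operator of the lifted data and $(P_t)_{t\in\mathbb{N}_0}$ the bounded positive definite solution of $P_t=\mathcal{R}_t(P_{t+1})$. Given $T\in\mathbb{N}$, consider the $T$-step receding-horizon policy $\tilde u_t=\mu_0^{RH}(t,\tilde x_t)$ with terminal penalty matrices $$X_{t+T}=\tilde Q_{t+T}+\tilde A_{t+T}'(\tilde B_{t+T}\tilde B_{t+T}')^{-1}\tilde B_{t+T}\tilde R_{t+T}\tilde B_{t+T}'(\tilde B_{t+T}\tilde B_{t+T}')^{-1}\tilde A_{t+T},\qquad t\in\mathbb{N}_0.$$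 For $t\in\mathbb{N}_0$ let $\hat X_{t+1}:=\mathcal{R}_{t+1}\circ\cdots\circ\mathcal{R}_{t+T-1}(X_{t+T})$ (so $\hat X_{t+1}=X_{t+1}$ if $T=1$) and $K_t:=(\tilde R_t+\tilde B_t'\hat X_{t+1}\tilde B_t)^{-1}\tilde B_t'\hat X_{t+1}\tilde A_t$, and define $$\overline\omega:=\sup_{t\in\mathbb{N}_0}\|\mathcal{R}_t(\hat X_{t+1})\|_2,\quad \underline\omega:=\inf_{t\in\mathbb{N}_0}\lambda_{\min}(\mathcal{R}_t(\hat X_{t+1})),\quad \underline\lambda:=\inf_{t\in\mathbb{N}_0}\lambda_{\min}(\tilde Q_t+K_t'\tilde R_tK_t),\quad \overline\lambda:=\sup_{t\in\mathbb{N}_0}\|P_t\|_2,$$ $$\overline\delta:=\sqrt n\,\log\Big(\sup_{t\in\mathbb{N}_0}\frac{\|X_{t+T}\|_2}{\lambda_{\min}(P_{t+T})}\Big),\qquad \overline\zeta:=\sup_{t\in\mathbb{N}_0}\zeta_t,\qquad \underline\epsilon:=\inf_{t\in\mathbb{N}_0}\epsilon_t,$$ where $$\zeta_t:=\big\|(\tilde Q_t+\tilde Q_t\tilde A_t^{-1}\tilde B_t\tilde R_t^{-1}\tilde B_t'(\tilde A_t')^{-1}\tilde Q_t)^{-1}\big\|_2,$$ $$\epsilon_t:=\lambda_{\min}\big(\tilde A_t^{-1}\tilde B_t(\tilde R_t+\tilde B_t'(\tilde A_t')^{-1}\tilde Q_t\tilde A_t^{-1}\tilde B_t)^{-1}\tilde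 B_t'(\tilde A_t')^{-1}\big);$$ all seven constants are finite and strictly positive. Let $\overline\beta>0$. If $$T\ge\frac{\log\left(\dfrac{1}{\overline\delta}\log\Big(\dfrac{\overline\beta\,\underline\lambda\,\underline\omega}{\overline\omega\,\overline\lambda\,\overline\omega}+1\Big)\right)}{\log\Big(\dfrac{\overline\zeta}{\overline\zeta+\underline\epsilon}\Big)}+1,$$ then the infinite-horizon performance loss of the receding-horizon policy satisfies $\beta(\xi)\le\overline\beta|\xi|^2$ for all initial states $\xi\in\mathbb{R}^n$.
   Context: Notation: $\mathbb{N}_0=\mathbb{N}\cup\{0\}$; $M'$ is the transpose; $|\cdot|$ is the Euclidean norm, $\|\cdot\|_2$ the induced (spectral) norm; $\mathbb{S}^n,\mathbb{S}^n_+,\mathbb{S}^n_{++}$ are the real symmetric, positive semi-definite, positive definite $n\times n$ matrices; $\lambda_{\min}$ is the smallest eigenvalue. Controllability and observability matrices: $\Theta_{k,d}:=A_{k+d-1}A_{k+d-2}\cdots A_k$, $\Theta_{k,0}:=I_n$, $C_k:=Q_k^{1/2}$, $\mathcal{C}_{k,d}:=[\,\Theta_{k+1,d-1}B_k\;\;\Theta_{k+2,d-2}B_{k+1}\;\cdots\;\Theta_{k+d,0}B_{k+d-1}\,]$, and $\mathcal{O}_{k,d}$ is the vertical stack of $C_k\Theta_{k,0},\,C_{k+1}\Theta_{k,1},\dots,C_{k+d}\Theta_{k,d}$. Lifted data: for $t\in\mathbb{N}_0$, $\hat A_t:=I_{n(d+1)}-\begin{bmatrix}0_{n,nd}&0_{n,n}\\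 \mathrm{diag}(A_{dt},\dots,A_{d(t+1)-1})&0_{nd,n}\end{bmatrix}$, $\hat B_t:=\begin{bmatrix}0_{n,md}\\ \mathrm{diag}(B_{dt},\dots,B_{d(t+1)-1})\end{bmatrix}$, $\hat C_t:=[\,\mathrm{diag}(C_{dt},\dots,C_{d(t+1)-1})\;\;0_{nd,n}\,]$ (block-diagonal matrices); $\Phi_t:=[0_{n,nd}\;I_n]\hat A_t^{-1}\begin{bmatrix}I_n\\0_{nd,n}\end{bmatrix}$, $\Gamma_t:=[0_{n,nd}\;I_n]\hat A_t^{-1}\hat B_t$, $\Xi_t:=\hat C_t\hat A_t^{-1}\begin{bmatrix}I_n\\0_{nd,n}\end{bmatrix}$, $\Delta_t:=\hat C_t\hat A_t^{-1}\hat B_t$; $\tilde R_t:=\mathrm{diag}(R_{dt},\dots,R_{dt+d-1})+\Delta_t'\Delta_t$, $\tilde Q_t:=\Xi_t'\Xi_t-\Xi_t'\Delta_t\tilde R_t^{-1}\Delta_t'\Xi_t$, $\tilde A_t:=\Phi_t-\Gamma_t\tilde R_t^{-1}\Delta_t'\Xi_t$, $\tilde B_t:=\Gamma_t$. Riccati operator: $\mathcal{R}_t(P):=\tilde Q_t+\tilde A_t'\big(P-P\tilde B_t(\tilde R_t+\tilde B_t'P\tilde B_t)^{-1}\tilde B_t'P\big)\tilde A_t$ for $P\in\mathbb{S}^n_+$. Under the stated hypotheses the recursion $P_t=\mathcal{R}_t(P_{t+1})$, $t\in\mathbb{N}_0$ (no boundary condition), has a unique bounded positive semi-definite solution $(P_t)_{t\in\mathbb{N}_0}$,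 and it is positive definite (known background fact). Receding-horizon policy: for $t\in\mathbb{N}_0$, $\chi\in\mathbb{R}^n$, $w=(w_t,\dots,w_{t+T-1})\in((\mathbb{R}^m)^d)^T$, $X\in\mathbb{S}^n_{++}$, let $z_t=\chi$, $z_{j+1}=\tilde A_jz_j+\tilde B_jw_j$ for $t\le j\le t+T-1$, and $L_T(t,\chi,w,X):=\sum_{j=t}^{t+T-1}(z_j'\tilde Q_jz_j+w_j'\tilde R_jw_j)+z_{t+T}'Xz_{t+T}$. The policy is defined by $(\mu^{RH}_0(t,\tilde x_t),\dots,\mu^{RH}_{T-1}(t,\tilde x_t))=\arg\min_{w}L_T(t,\tilde x_t,w,X_{t+T})$, and only the first element $\mu_0^{RH}$ is applied. Performance loss: for an input sequence $\tilde u=(\tilde u_0,\tilde u_1,\dots)$ in $(\mathbb{R}^m)^d$, let $\tilde x_0=\xi$, $\tilde x_{t+1}=\tilde A_t\tilde x_t+\tilde B_t\tilde u_t$, and $J(0,\xi,\tilde u):=\lim_{N\to\infty}\sum_{t=0}^{N-1}(\tilde x_t'\tilde Q_t\tilde x_t+\tilde u_t'\tilde R_t\tilde u_t)$. The performance loss is $\beta(\xi):=J(0,\xi,\tilde u)-\min_{\tilde v}J(0,\xi,\tilde v)$, with $\tilde u$ the input generated by the policy under consideration from $\tilde x_0=\xi$ and the minimum over all input sequences $\tilde v$; the minimum equals $\xi'P_0\xi$ (known background fact). *)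

(* Defs.v *)
(* MathComp-Analysis: real matrices over an arbitrary [R : realType]. *)
From HB Require Import structures.
From mathcomp Require Import all_boot all_order all_algebra.
From mathcomp Require Import all_classical all_reals all_analysis.

Set Implicit Arguments.
Unset Strict Implicit.
Unset Printing Implicit Defensive.

Import Order.TTheory GRing.Theory Num.Theory.
Import numFieldNormedType.Exports.

Local Open Scope classical_set_scope.
Local Open Scope ring_scope.

Definition qform (R : realType) n (M : 'M[R]_n) (x : 'cV[R]_n) : R :=
  (x^T *m M *m x) ord0 ord0.

Definition psd (R : realType) n (M : 'M[R]_n) : Prop :=
  M^T = M /\ forall x : 'cV[R]_n, 0 <= qform M x.

Definition pd (R : realType) n (M : 'M[R]_n) : Prop :=
  M^T = M /\ forall x : 'cV[R]_n, x != 0 -> 0 < qform M x.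

Definition enorm (R : realType) n (x : 'cV[R]_n) : R :=
  Num.sqrt (\sum_i x i ord0 ^+ 2).

(* Norm induced by [enorm]; MathComp-Analysis's own `|M| on matrices is the
   entrywise maximum. *)
Definition norm2 (R : realType) m n (M : 'M[R]_(m, n)) : R :=
  sup [set enorm (M *m x) | x in [set x : 'cV[R]_n | enorm x <= 1]].

(* Used on symmetric matrices of positive size, whose set of eigenvalues is
   finite and non-empty, so that the infimum is a minimum. *)
Definition lambda_min (R : realType) n (M : 'M[R]_n) : R :=
  inf [set a | eigenvalue M a].

(* The unique positive semi-definite square root of a positive semi-definite
   matrix. *)
Definition psd_sqrt (R : realType) n (M : 'M[R]_n) : 'M[R]_n :=
  xget 0 [set S | psd S /\ S *m S = M].

Definition unif_bounded (R : realType) m n (M : nat -> 'M[R]_(m, n)) : Prop :=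
  has_ubound (range (fun k => norm2 (M k))).

(* Data of a time-varying linear-quadratic problem: dynamics
   x_{k+1} = A_k x_k + B_k u_k, stage cost x_k' Q_k x_k + u_k' R_k u_k. *)
Record lqdata (R : realType) (n m : nat) := LQData {
  lqA : nat -> 'M[R]_n;
  lqB : nat -> 'M[R]_(n, m);
  lqQ : nat -> 'M[R]_n;
  lqR : nat -> 'M[R]_m }.

Fixpoint Theta (R : realType) n m (S : lqdata R n m) (k d : nat) : 'M[R]_n :=
  if d is d'.+1 then lqA S (k + d') *m Theta S k d' else 1%:M.

Definition lqC (R : realType) n m (S : lqdata R n m) (k : nat) : 'M[R]_n :=
  psd_sqrt (lqQ S k).

Definition ctrb (R : realType) n m (S : lqdata R n m) (k d : nat) :
    'M[R]_(n, \sum_(i < d) m) :=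
  \mxrow_(i < d) (Theta S (k + i.+1) (d - i.+1) *m lqB S (k + i)).

Definition obsv (R : realType) n m (S : lqdata R n m) (k d : nat) :
    'M[R]_(\sum_(i < d.+1) n, n) :=
  \mxcol_(i < d.+1) (lqC S (k + i) *m Theta S k i).

(* Lifting. The sizes n(d+1), nd and md are represented by the sums
   \sum_(i < d.+1) n, \sum_(i < d) n, \sum_(i < d) m.
   A block column of d blocks placed below a zero block row is written directly
   as a matrix of blocks, block (i, j) being non-zero when i = j + 1. *)
Definition liftA (R : realType) n m (S : lqdata R n m) (d t : nat) :
    'M[R]_(\sum_(i < d.+1) n) :=
  1%:M - \mxblock_(i < d.+1, j < d.+1)
           (if i == j.+1 :> nat then lqA S (d * t + j) else 0).

Definition liftB (R : realType) n m (S : lqdata R n m) (d t : nat) :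
    'M[R]_(\sum_(i < d.+1) n, \sum_(j < d) m) :=
  \mxblock_(i < d.+1, j < d)
    (if i == j.+1 :> nat then lqB S (d * t + j) else 0).

Definition liftC (R : realType) n m (S : lqdata R n m) (d t : nat) :
    'M[R]_(\sum_(i < d) n, \sum_(j < d.+1) n) :=
  \mxblock_(i < d, j < d.+1)
    (if i == j :> nat then lqC S (d * t + i) else 0).

(* [0 I_n], the selector of the last block. *)
Definition sel_last (R : realType) (n d : nat) : 'M[R]_(n, \sum_(i < d.+1) n) :=
  \mxrow_(i < d.+1) (if i == d :> nat then 1%:M else 0 : 'M[R]_n).

(* [I_n; 0], the injection of the first block. *)
Definition inj_first (R : realType) (n d : nat) : 'M[R]_(\sum_(i < d.+1) n, n) :=
  \mxcol_(i < d.+1) (if i == 0%N :> nat then 1%:M else 0 : 'M[R]_n).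

Definition liftPhi (R : realType) n m (S : lqdata R n m) d t : 'M[R]_n :=
  sel_last R n d *m invmx (liftA S d t) *m inj_first R n d.

Definition liftGamma (R : realType) n m (S : lqdata R n m) d t :
    'M[R]_(n, \sum_(i < d) m) :=
  sel_last R n d *m invmx (liftA S d t) *m liftB S d t.

Definition liftXi (R : realType) n m (S : lqdata R n m) d t :
    'M[R]_(\sum_(i < d) n, n) :=
  liftC S d t *m invmx (liftA S d t) *m inj_first R n d.

Definition liftDelta (R : realType) n m (S : lqdata R n m) d t :
    'M[R]_(\sum_(i < d) n, \sum_(i < d) m) :=
  liftC S d t *m invmx (liftA S d t) *m liftB S d t.

Definition tildeR (R : realType) n m (S : lqdata R n m) d t :
    'M[R]_(\sum_(i < d) m) :=
  (\mxdiag_(i < d) lqR S (d * t + i))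
  + (liftDelta S d t)^T *m liftDelta S d t.

Definition tildeQ (R : realType) n m (S : lqdata R n m) d t : 'M[R]_n :=
  let Xi := liftXi S d t in let Delta := liftDelta S d t in
  Xi^T *m Xi - Xi^T *m Delta *m invmx (tildeR S d t) *m Delta^T *m Xi.

Definition tildeA (R : realType) n m (S : lqdata R n m) d t : 'M[R]_n :=
  liftPhi S d t
  - liftGamma S d t *m invmx (tildeR S d t) *m (liftDelta S d t)^T
      *m liftXi S d t.

(* The lifted problem is again a linear-quadratic problem, with state in R^n
   and input in (R^m)^d. *)
Definition lifted (R : realType) n m (S : lqdata R n m) (d : nat) :
    lqdata R n (\sum_(i < d) m) :=
  LQData (tildeA S d) (liftGamma S d) (tildeQ S d) (tildeR S d).

Definition riccati (R : realType) n m (S : lqdata R n m) (t : nat)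
    (P : 'M[R]_n) : 'M[R]_n :=
  let A := lqA S t in let B := lqB S t in
  lqQ S t + A^T *m
    (P - P *m B *m invmx (lqR S t + B^T *m P *m B) *m B^T *m P) *m A.

(* riccati_t o riccati_{t+1} o ... o riccati_{t+j-1} *)
Fixpoint riccati_comp (R : realType) n m (S : lqdata R n m) (t j : nat)
    (X : 'M[R]_n) : 'M[R]_n :=
  if j is j'.+1 then riccati S t (riccati_comp S t.+1 j' X) else X.

Definition stage_cost (R : realType) n m (S : lqdata R n m) (t : nat)
    (x : 'cV[R]_n) (u : 'cV[R]_m) : R :=
  qform (lqQ S t) x + qform (lqR S t) u.

(* State at time t + j, starting from x at time t; u j is applied at time
   t + j. *)
Fixpoint traj (R : realType) n m (S : lqdata R n m) (t : nat) (x : 'cV[R]_n)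
    (u : nat -> 'cV[R]_m) (j : nat) : 'cV[R]_n :=
  if j is j'.+1
  then lqA S (t + j') *m traj S t x u j' + lqB S (t + j') *m u j'
  else x.

(* L_T(t, x, w, X); w`_j is the input applied at time t + j. *)
Definition rh_cost (R : realType) n m (S : lqdata R n m) (T t : nat)
    (x : 'cV[R]_n) (w : T.-tuple 'cV[R]_m) (X : 'M[R]_n) : R :=
  let z := traj S t x (fun j => w`_j) in
  (\sum_(j < T) stage_cost S (t + j) (z j) w`_j) + qform X (z T).

Definition rh_argmin (R : realType) n m (S : lqdata R n m) (T t : nat)
    (x : 'cV[R]_n) (X : 'M[R]_n) : T.-tuple 'cV[R]_m :=
  xget (nseq_tuple T 0)
    [set w | forall w' : T.-tuple 'cV[R]_m,
       rh_cost S t x w X <= rh_cost S t x w' X].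

(* Xterm s is the terminal penalty matrix used when the horizon ends at time
   s. *)
Definition rh_policy (R : realType) n m (S : lqdata R n m) (T : nat)
    (Xterm : nat -> 'M[R]_n) (t : nat) (x : 'cV[R]_n) : 'cV[R]_m :=
  (rh_argmin S T t x (Xterm (t + T)%N))`_0.

Fixpoint closed_loop (R : realType) n m (S : lqdata R n m)
    (mu : nat -> 'cV[R]_n -> 'cV[R]_m) (xi : 'cV[R]_n) (t : nat) : 'cV[R]_n :=
  if t is t'.+1
  then let x := closed_loop S mu xi t' in lqA S t' *m x + lqB S t' *m mu t' x
  else xi.

Definition policy_input (R : realType) n m (S : lqdata R n m)
    (mu : nat -> 'cV[R]_n -> 'cV[R]_m) (xi : 'cV[R]_n) (t : nat) : 'cV[R]_m :=
  mu t (closed_loop S mu xi t).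

(* J(0, xi, u), with value +oo when the non-negative series diverges. *)
Definition total_cost (R : realType) n m (S : lqdata R n m) (xi : 'cV[R]_n)
    (u : nat -> 'cV[R]_m) : \bar R :=
  limn (fun N =>
    (\sum_(0 <= t < N) stage_cost S t (traj S 0 xi u t) (u t))%:E).

(* beta(xi). The subtracted term is the optimal value: the infimum is attained
   and finite in the setting where this is used. *)
Definition perf_loss (R : realType) n m (S : lqdata R n m)
    (mu : nat -> 'cV[R]_n -> 'cV[R]_m) (xi : 'cV[R]_n) : \bar R :=
  (total_cost S xi (policy_input S mu xi)
   - ereal_inf (range (total_cost S xi)))%E.

Definition Xterm (R : realType) n m (S : lqdata R n m) (t : nat) : 'M[R]_n :=
  let A := lqA S t in let B := lqB S t in let BB := B *m B^T in
  lqQ S t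
  + A^T *m invmx BB *m B *m lqR S t *m B^T *m invmx BB *m A.

(* [Xhat S T t] is \hat X_{t+1}: the index is shifted by one. *)
Definition Xhat (R : realType) n m (S : lqdata R n m) (T t : nat) : 'M[R]_n :=
  riccati_comp S t.+1 T.-1 (Xterm S (t + T)).

Definition Kgain (R : realType) n m (S : lqdata R n m) (T t : nat) :
    'M[R]_(m, n) :=
  let B := lqB S t in let X := Xhat S T t in
  invmx (lqR S t + B^T *m X *m B) *m B^T *m X *m lqA S t.

(* The sequences whose suprema and infima are the seven constants. *)
Definition omega_max_seq (R : realType) n m (S : lqdata R n m) T t : R :=
  norm2 (riccati S t (Xhat S T t)).

Definition omega_min_seq (R : realType) n m (S : lqdata R n m) T t : R :=
  lambda_min (riccati S t (Xhat S T t)).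

Definition lambda_min_seq (R : realType) n m (S : lqdata R n m) T t : R :=
  let K := Kgain S T t in lambda_min (lqQ S t + K^T *m lqR S t *m K).

Definition delta_ratio (R : realType) n m (S : lqdata R n m)
    (P : nat -> 'M[R]_n) T t : R :=
  norm2 (Xterm S (t + T)) / lambda_min (P (t + T)%N).

Definition zeta_seq (R : realType) n m (S : lqdata R n m) t : R :=
  let Q := lqQ S t in let A := lqA S t in let B := lqB S t in
  norm2 (invmx (Q + Q *m invmx A *m B *m invmx (lqR S t)
                      *m B^T *m invmx A^T *m Q)).

Definition epsilon_seq (R : realType) n m (S : lqdata R n m) t : R :=
  let Q := lqQ S t in let A := lqA S t in let B := lqB S t in
  lambda_min (invmx A *m B
    *m invmx (lqR S t + B^T *m invmx A^T *m Q *m invmx A *m B)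
    *m B^T *m invmx A^T).

Definition omega_max (R : realType) n m (S : lqdata R n m) T : R :=
  sup (range (omega_max_seq S T)).

Definition omega_min (R : realType) n m (S : lqdata R n m) T : R :=
  inf (range (omega_min_seq S T)).

Definition lambda_lo (R : realType) n m (S : lqdata R n m) T : R :=
  inf (range (lambda_min_seq S T)).

Definition lambda_hi (R : realType) n (P : nat -> 'M[R]_n) : R :=
  sup (range (fun t => norm2 (P t))).

Definition delta_max (R : realType) n m (S : lqdata R n m)
    (P : nat -> 'M[R]_n) T : R :=
  Num.sqrt n%:R * ln (sup (range (delta_ratio S P T))).

Definition zeta_max (R : realType) n m (S : lqdata R n m) : R :=
  sup (range (zeta_seq S)).

Definition epsilon_min (R : realType) n m (S : lqdata R n m) : R :=
  inf (range (epsilon_seq S)).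

(* The real-valued sup and inf are 0 on unbounded sets, hence the separate
   boundedness clauses. *)
Definition constants_finite_positive (R : realType) n m (S : lqdata R n m)
    (P : nat -> 'M[R]_n) (T : nat) : Prop :=
  [/\ has_ubound (range (omega_max_seq S T)) /\ 0 < omega_max S T,
      has_lbound (range (omega_min_seq S T)) /\ 0 < omega_min S T,
      has_lbound (range (lambda_min_seq S T)) /\ 0 < lambda_lo S T &
      has_ubound (range (fun t => norm2 (P t))) /\ 0 < lambda_hi P] /\
  [/\ has_ubound (range (delta_ratio S P T)) /\ 0 < delta_max S P T,
      has_ubound (range (zeta_seq S)) /\ 0 < zeta_max S &
      has_lbound (range (epsilon_seq S)) /\ 0 < epsilon_min S].

(* Main.v *)
(* Write R_t for the Riccati operator of the lifted problem and
   W_t = R_t (Xhat_{t+1}). The dead-beat input steers any state to 0 in one step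
   at cost X_t, so R_t (Y) <= X_t for every Y >= 0; hence W_{t+1} <= Xhat_{t+1},
   the values x_t' W_t x_t telescope along the closed loop, and the policy costs
   at most xi' W_0 xi. The loss is thus at most xi' (W_0 - P_0) xi.

   The relative order X <= e^s P is contracted by R_t into
   R_t (X) <= e^(g s) R_t (P), g = zeta / (zeta + epsilon): this replaces the
   Riemannian metric on positive definite matrices, and gives
   W_0 <= (1 + c) P_0 under the horizon condition.

   For the finiteness of the constants the difficulty is that R_k has no uniform
   positive lower bound, so that the feedback hidden in \tilde A_t may be
   unbounded. But det \tilde A_t = det Phi_t det R / det \tilde R_t (R the
   block-diagonal input weight), which is bounded by det Phi_t in absolute
   value; as \tilde A_t^-1 is bounded, so is
   \tilde A_t = det (\tilde A_t) adj (\tilde A_t^-1). *)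

Require Import Defs.
From mathcomp Require Import all_boot all_order all_algebra.
From mathcomp Require Import all_classical all_reals all_analysis.
From mathcomp Require Import perm ring lra.

Set Implicit Arguments.
Unset Strict Implicit.
Unset Printing Implicit Defensive.

Import Order.TTheory GRing.Theory Num.Theory.
Import numFieldNormedType.Exports.

Local Open Scope classical_set_scope.
Local Open Scope ring_scope.

(** * Quadratic forms *)

(** Inversion turns the Riccati map into an infimal convolution: in [invmx (riccati S t P)] the
    matrix [P] enters only through the additive term [qform (invmx P) l], with [l] the costate, so
    the effect of rescaling [P] can be measured, whereas [riccati] itself mixes [P] with the input
    weight. The comparisons between forms and their inverses rest on the inequality [fenchel]. The
    terminal comparison is [Xterm <= s P], where [s] bounds the ratios of [norm2 Xterm] to
    [lambda_min P]. The T - 1 inner operators reduce its exponent to g^(T-1) ln s, and the horizon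
    condition, solved for this quantity, bounds it by ln (1 + c) with c = bbar lambda_lo omega_min /
    (omega_max lambda_hi omega_max). Both [lambda_lo] and [omega_min] are at most [omega_max], hence
    c lambda_hi <= bbar. The determinant identity holds because Sylvester's identity moves the
    feedback to the input space, where the block-diagonal input weight is perturbed by a product of
    two anticausal maps, which is strictly block triangular. *)

Definition dot (R : realType) n (x y : 'cV[R]_n) : R := (x^T *m y) ord0 ord0.

Section Dot.
Variables (R : realType) (n : nat).
Implicit Types (x y z : 'cV[R]_n) (M N : 'M[R]_n) (a c : R).

Lemma dotE x y : dot x y = \sum_i x i ord0 * y i ord0.
Proof. by rewrite /dot mxE; apply: eq_bigr => i _; rewrite mxE. Qed.

Lemma dotC x y : dot x y = dot y x.
Proof. by rewrite !dotE; apply: eq_bigr => i _; rewrite mulrC. Qed.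

Lemma dotDr x y z : dot x (y + z) = dot x y + dot x z.
Proof. by rewrite /dot mulmxDr mxE. Qed.

Lemma dotZr a x y : dot x (a *: y) = a * dot x y.
Proof. by rewrite /dot -scalemxAr mxE. Qed.

Lemma dotNr x y : dot x (- y) = - dot x y.
Proof. by rewrite /dot mulmxN mxE. Qed.

Lemma dotDl x y z : dot (x + y) z = dot x z + dot y z.
Proof. by rewrite dotC dotDr !(dotC z). Qed.

Lemma dotZl a x y : dot (a *: x) y = a * dot x y.
Proof. by rewrite dotC dotZr dotC. Qed.

Lemma dotNl x y : dot (- x) y = - dot x y.
Proof. by rewrite dotC dotNr dotC. Qed.

Lemma dotBl x y z : dot (x - y) z = dot x z - dot y z.
Proof. by rewrite dotDl dotNl. Qed.

Lemma dot0l x : dot 0 x = 0.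
Proof. by rewrite -(scale0r 0) dotZl mul0r. Qed.

Lemma dotxx x : dot x x = enorm x ^+ 2.
Proof.
rewrite /enorm sqr_sqrtr ?dotE; last by apply: sumr_ge0 => i _; rewrite sqr_ge0.
by apply: eq_bigr => i _; rewrite expr2.
Qed.

Lemma enorm_ge0 x : 0 <= enorm x.
Proof. exact: sqrtr_ge0. Qed.

Lemma enorm_eq0 x : (enorm x == 0) = (x == 0).
Proof.
apply/idP/eqP => [|->]; last first.
  by rewrite -sqrf_eq0 -dotxx dot0l.
rewrite -sqrf_eq0 -dotxx dotE psumr_eq0 => [/allP h|i _]; last first.
  by rewrite -expr2 sqr_ge0.
apply/colP => i; have := h i; rewrite mem_index_enum mulf_eq0 orbb mxE.
by move=> /(_ isT)/eqP.
Qed.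

Lemma enorm0 : enorm (0 : 'cV[R]_n) = 0.
Proof. by apply/eqP; rewrite enorm_eq0. Qed.

Lemma enorm_gt0 x : x != 0 -> 0 < enorm x.
Proof. by move=> x0; rewrite lt_def enorm_eq0 x0 enorm_ge0. Qed.

Lemma enormZ a x : enorm (a *: x) = `|a| * enorm x.
Proof.
apply: (@pexpIrn _ 2) => //; rewrite ?nnegrE ?mulr_ge0 ?enorm_ge0 //.
by rewrite exprMn -!dotxx dotZl dotZr mulrA real_normK ?num_real // expr2.
Qed.

Lemma qformE M x : qform M x = dot x (M *m x).
Proof. by rewrite /qform /dot mulmxA. Qed.

Lemma qformD M N x : qform (M + N) x = qform M x + qform N x.
Proof. by rewrite !qformE mulmxDl dotDr. Qed.

Lemma qformN M x : qform (- M) x = - qform M x.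
Proof. by rewrite !qformE mulNmx dotNr. Qed.

Lemma qformZ a M x : qform (a *: M) x = a * qform M x.
Proof. by rewrite !qformE -scalemxAl dotZr. Qed.

Lemma qform_scalar a x : qform a%:M x = a * enorm x ^+ 2.
Proof. by rewrite qformE mul_scalar_mx dotZr dotxx. Qed.

Lemma qformZx M a x : qform M (a *: x) = a ^+ 2 * qform M x.
Proof. by rewrite !qformE -scalemxAr dotZl dotZr mulrA expr2. Qed.

Lemma qformNx M x : qform M (- x) = qform M x.
Proof. by rewrite -scaleN1r qformZx sqrrN expr1n mul1r. Qed.

Lemma qform0x M : qform M 0 = 0.
Proof. by rewrite qformE dot0l. Qed.

End Dot.

Lemma dot_mulmx (R : realType) m n (M : 'M[R]_(m, n)) x y :
  dot x (M *m y) = dot (M^T *m x) y.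
Proof. by rewrite /dot trmx_mul trmxK mulmxA. Qed.

Lemma qform_cong (R : realType) m n (M : 'M[R]_m) (N : 'M[R]_(m, n)) x :
  qform (N^T *m M *m N) x = qform M (N *m x).
Proof. by rewrite !qformE -!mulmxA dot_mulmx trmxK. Qed.

Lemma qform_gram (R : realType) m n (N : 'M[R]_(m, n)) x :
  qform (N^T *m N) x = enorm (N *m x) ^+ 2.
Proof. by rewrite qformE -mulmxA dot_mulmx trmxK dotxx. Qed.

Lemma psd_cong (R : realType) m n (M : 'M[R]_m) (N : 'M[R]_(m, n)) :
  psd M -> psd (N^T *m M *m N).
Proof.
by case=> sM pM; split=> [|x]; rewrite ?qform_cong // !trmx_mul trmxK sM mulmxA.
Qed.

Lemma psd_gram (R : realType) m n (N : 'M[R]_(m, n)) : psd (N^T *m N).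
Proof.
by split=> [|x]; rewrite ?qform_gram ?sqr_ge0 // trmx_mul trmxK.
Qed.

Section PosDef.
Variables (R : realType) (n : nat).
Implicit Types (x y z : 'cV[R]_n) (M N : 'M[R]_n) (a c : R).

Lemma dot_sym M x y : M^T = M -> dot x (M *m y) = dot y (M *m x).
Proof. by move=> sM; rewrite dot_mulmx sM dotC. Qed.

Lemma qform_add M x y : M^T = M ->
  qform M (x + y) = qform M x + 2 * dot x (M *m y) + qform M y.
Proof.
move=> sM; rewrite !qformE mulmxDr !dotDr !dotDl (dot_sym y x sM); ring.
Qed.

Lemma qform_sub M x y : M^T = M ->
  qform M (x - y) = qform M x - 2 * dot x (M *m y) + qform M y.
Proof.
move=> sM; rewrite qform_add // !qformE mulmxN !dotNr dotNl; ring.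
Qed.

Lemma pd_psd M : pd M -> psd M.
Proof.
case=> sM pM; split=> // x; have [->|x0] := eqVneq x 0; first by rewrite qform0x.
exact/ltW/pM.
Qed.

Lemma pdDl M N : pd M -> psd N -> pd (M + N).
Proof.
case=> sM pM [sN pN]; split=> [|x x0]; first by rewrite linearD /= sM sN.
by rewrite qformD ltr_wpDr // pM.
Qed.

Lemma pd_ge M c : M^T = M -> 0 < c ->
  (forall x, c * enorm x ^+ 2 <= qform M x) -> pd M.
Proof.
move=> sM c0 h; split=> // x x0; apply: lt_le_trans (h x).
by rewrite mulr_gt0 // exprn_gt0 // enorm_gt0.
Qed.

Lemma unitmx_inj M : (forall x, M *m x = 0 -> x = 0) -> M \in unitmx.
Proof.
move=> h; rewrite -unitmx_tr -row_free_unit; apply: inj_row_free => v vM.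
apply: trmx_inj; rewrite trmx0; apply: h.
by rewrite -[M]trmxK -trmx_mul vM trmx0.
Qed.

Lemma pd_unit M : pd M -> M \in unitmx.
Proof.
case=> sM pM; apply: unitmx_inj => x Mx; apply/eqP; apply: contraT => /pM.
by rewrite qformE Mx dotC dot0l ltxx.
Qed.

Lemma qform_inv M x : M^T = M -> M \in unitmx ->
  qform (invmx M) x = qform M (invmx M *m x).
Proof.
by move=> sM uM; rewrite !qformE mulKVmx // [RHS]dotC.
Qed.

Lemma pd_inv M : pd M -> pd (invmx M).
Proof.
move=> pM; have uM := pd_unit pM; case: pM => sM pM.
split=> [|x x0]; first by rewrite trmx_inv sM.
rewrite qform_inv // pM //; apply: contra_neq x0 => h.
by rewrite -[x](mulKVmx uM) h mulmx0.
Qed.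

(** Nonnegativity of the form at [invmx M *m x - y], expanded. Equality holds at [x = M *m y], which
    is the content of [fenchel_eq]. *)
Lemma fenchel M x y : pd M ->
  2 * dot x y - qform M y <= qform (invmx M) x.
Proof.
move=> pM; have uM := pd_unit pM; have [sM /(_ (invmx M *m x - y)) h] := pd_psd pM.
move: h; rewrite qform_sub // -qform_inv // (dot_sym _ _ sM) mulKVmx // (dotC y).
lra.
Qed.

Lemma fenchel_eq M y : pd M -> qform (invmx M) (M *m y) = qform M y.
Proof. by move=> pM; rewrite qform_inv ?mulKmx ?pd_unit //; case: pM. Qed.

(** Inversion reverses the order of forms. Fenchel's inequality for [M] is tested at
    [c *: (invmx N *m p)], a multiple of the vector where the one for [N] is an equality. *)
Lemma inv_le_scale M N c : pd M -> pd N -> 0 < c ->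
  (forall x, c * qform M x <= qform N x) ->
  forall p, c * qform (invmx N) p <= qform (invmx M) p.
Proof.
move=> pM pN c0 h p; have uN := pd_unit pN.
have := fenchel p (c *: (invmx N *m p)) pM; apply: le_trans.
rewrite qformZx dotZr expr2 -mulrA -qformE.
have := h (invmx N *m p); rewrite -qform_inv //; last by case: pN.
by move=> /(ler_wpM2l (ltW c0)); lra.
Qed.

Lemma cauchy_schwarz M x y : psd M ->
  dot x (M *m y) ^+ 2 <= qform M x * qform M y.
Proof.
move=> [sM pM]; set a := qform M x; set b := dot _ _; set c := qform M y.
have h (s t : R) : 0 <= s ^+ 2 * a - 2 * (s * t * b) + t ^+ 2 * c.
  have := pM (s *: x - t *: y); rewrite qform_sub // !qformZx -scalemxAr.
  by rewrite dotZl dotZr -/a -/b -/c !mulrA.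
have a0 : 0 <= a := pM x; have c0 : 0 <= c := pM y.
move: c0; rewrite le_eqVlt => /orP[/eqP c0|c0]; last first.
  have := h c b; have -> : c ^+ 2 * a - 2 * (c * b * b) + b ^+ 2 * c
    = c * (a * c - b ^+ 2) by ring.
  by rewrite pmulr_rge0 // subr_ge0.
(* Degenerate case [c = 0]. The choice [t = a + 1], rather than [a], leaves a strictly negative
   multiple of [b ^+ 2] even when [a] vanishes too. *)
have := h b (a + 1); rewrite -c0 !mulr0 addr0.
have -> : b ^+ 2 * a - 2 * (b * (a + 1) * b) = - ((a + 2) * b ^+ 2) by ring.
by rewrite oppr_ge0 pmulr_rle0 // ltr_wpDl.
Qed.

Lemma psd_enorm_mul_le M c x : psd M -> 0 <= c ->
  (forall y, qform M y <= c * enorm y ^+ 2) ->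
  enorm (M *m x) ^+ 2 <= c * qform M x.
Proof.
move=> pM c0 h; set y := M *m x; have := cauchy_schwarz y x pM.
rewrite -/y dotxx => cs; have := h y; set e := enorm y ^+ 2 in cs *.
have : 0 <= e by rewrite sqr_ge0.
rewrite le_eqVlt => /orP[/eqP<- _|e0 hy].
  by rewrite mulr_ge0 //; case: pM.
rewrite -(ler_pM2l e0); apply: le_trans (_ : qform M y * qform M x <= _).
  by rewrite -expr2.
by rewrite mulrA (mulrC e) ler_wpM2r //; case: pM.
Qed.

Lemma cauchy_schwarz_enorm x y : `|dot x y| <= enorm x * enorm y.
Proof.
rewrite -(ler_pXn2r (_ : (0 < 2)%N)) ?nnegrE ?mulr_ge0 ?enorm_ge0 ?normr_ge0 //.
rewrite real_normK ?num_real // exprMn -[y in dot x y]mul1mx.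
rewrite -[enorm x ^+ 2]mul1r -[enorm y ^+ 2]mul1r -!qform_scalar.
apply: cauchy_schwarz; split=> [|z]; first by rewrite trmx1.
by rewrite qform_scalar mul1r sqr_ge0.
Qed.

End PosDef.

(** * Spectral norm and smallest eigenvalue *)

Section Norms.
Variable R : realType.

Lemma entry_le_enorm n (x : 'cV[R]_n) i : `|x i ord0| <= enorm x.
Proof.
rewrite -(ler_pXn2r (_ : (0 < 2)%N)) ?nnegrE ?enorm_ge0 ?normr_ge0 //.
rewrite real_normK ?num_real // -dotxx dotE (bigD1 i) //= -expr2 lerDl.
by apply: sumr_ge0 => j _; rewrite -expr2 sqr_ge0.
Qed.

Lemma enorm_mulmx_entry m n (M : 'M[R]_(m, n)) c :
  0 <= c -> (forall i j, `|M i j| <= c) ->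
  forall x, enorm (M *m x) ^+ 2 <= m%:R * (n%:R * c) ^+ 2 * enorm x ^+ 2.
Proof.
move=> c0 Mc x; have e0 := enorm_ge0 x.
rewrite -dotxx dotE -mulrA.
have -> : m%:R * ((n%:R * c) ^+ 2 * enorm x ^+ 2)
  = \sum_(i < m) (n%:R * c * enorm x) ^+ 2 :> R.
  by rewrite sumr_const card_ord mulr_natl -exprMn.
apply: ler_sum => i _; rewrite -expr2 -[X in X <= _]real_normK ?num_real //.
rewrite ler_pXn2r ?nnegrE ?normr_ge0 ?mulr_ge0 // mxE.
apply: le_trans (ler_norm_sum _ _ _) _.
have -> : n%:R * c * enorm x = \sum_(j < n) c * enorm x.
  by rewrite sumr_const card_ord -mulrA mulr_natl.
by apply: ler_sum => j _; rewrite normrM ler_pM ?entry_le_enorm.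
Qed.

Lemma enorm_mulmx_bound m n (M : 'M[R]_(m, n)) :
  exists2 c, 0 <= c & forall x, enorm (M *m x) ^+ 2 <= c * enorm x ^+ 2.
Proof.
pose c := \sum_i \sum_j `|M i j|.
have c0 : 0 <= c by apply: sumr_ge0 => i _; apply: sumr_ge0.
have hc i j : `|M i j| <= c.
  rewrite /c (bigD1 i) //= (bigD1 j) //= -addrA lerDl addr_ge0 //; apply: sumr_ge0 => //.
  by move=> k _; apply: sumr_ge0.
exists (m%:R * (n%:R * c) ^+ 2); first by rewrite mulr_ge0 ?sqr_ge0.
exact: enorm_mulmx_entry.
Qed.

Lemma enorm_le_sqr p q (x : 'cV[R]_p) (y : 'cV[R]_q) c : 0 <= c ->
  (enorm x ^+ 2 <= c ^+ 2 * enorm y ^+ 2) = (enorm x <= c * enorm y).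
Proof.
by move=> c0; rewrite -exprMn ler_pXn2r ?nnegrE ?mulr_ge0 ?enorm_ge0.
Qed.

Lemma norm2_has_sup m n (M : 'M[R]_(m, n)) :
  has_sup [set enorm (M *m x) | x in [set x : 'cV[R]_n | enorm x <= 1]].
Proof.
split; first by exists (enorm (M *m 0)); exists 0; rewrite /= ?enorm0.
have [c c0 hc] := enorm_mulmx_bound M; exists (Num.sqrt c) => _ [x /= x1 <-].
have := hc x; rewrite -{1}(sqr_sqrtr c0).
rewrite enorm_le_sqr ?sqrtr_ge0 // => /le_trans; apply.
by rewrite ler_piMr ?sqrtr_ge0.
Qed.

Lemma norm2_ge0 m n (M : 'M[R]_(m, n)) : 0 <= norm2 M.
Proof.
apply: sup_upper_bound; first exact: norm2_has_sup.
exists 0 => /=; first by rewrite enorm0.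
by apply/eqP; rewrite mulmx0 enorm_eq0.
Qed.

Lemma enorm_mulmx m n (M : 'M[R]_(m, n)) x :
  enorm (M *m x) <= norm2 M * enorm x.
Proof.
have [->|x0] := eqVneq x 0.
  by rewrite mulmx0 !enorm0 mulr0.
have e0 := enorm_gt0 x0; rewrite -ler_pdivrMr // mulrC.
have -> : (enorm x)^-1 * enorm (M *m x) = enorm (M *m ((enorm x)^-1 *: x)).
  by rewrite -scalemxAr enormZ ger0_norm // invr_ge0 ltW.
apply: sup_upper_bound; first exact: norm2_has_sup.
exists ((enorm x)^-1 *: x) => //=.
by rewrite enormZ ger0_norm ?invr_ge0 ?(ltW e0) // mulVf ?gt_eqF.
Qed.

Lemma norm2_le m n (M : 'M[R]_(m, n)) c : 0 <= c ->
  (forall x, enorm (M *m x) <= c * enorm x) -> norm2 M <= c.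
Proof.
move=> c0 h; apply: ge_sup; first by case: (norm2_has_sup M).
by move=> _ [x /= x1 <-]; apply: le_trans (h x) _; rewrite ler_piMr.
Qed.

Lemma qform_le_norm2 n (M : 'M[R]_n) x : qform M x <= norm2 M * enorm x ^+ 2.
Proof.
rewrite qformE; apply: le_trans (ler_norm _) _.
apply: le_trans (cauchy_schwarz_enorm _ _) _.
by rewrite expr2 mulrCA ler_wpM2l ?enorm_ge0 ?enorm_mulmx.
Qed.

Lemma norm2_psd_le n (M : 'M[R]_n) c : psd M -> 0 <= c ->
  (forall x, qform M x <= c * enorm x ^+ 2) -> norm2 M <= c.
Proof.
move=> pM c0 h; apply: norm2_le => // x; rewrite -enorm_le_sqr //.
apply: le_trans (psd_enorm_mul_le x pM c0 h) _.
by rewrite expr2 -mulrA ler_wpM2l.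
Qed.

Lemma exists_unit_vector n : (0 < n)%N -> exists x : 'cV[R]_n, enorm x = 1.
Proof.
case: n => // n _; exists (delta_mx ord0 ord0).
apply: (@pexpIrn _ 2) => //; rewrite ?nnegrE ?enorm_ge0 // -dotxx dotE.
rewrite big_ord_recl big1 => [|i _]; rewrite !mxE /= ?mulr0 //.
by rewrite addr0 mulr1 expr1n.
Qed.

Lemma norm2_pd_gt0 n (M : 'M[R]_n) : (0 < n)%N -> pd M -> 0 < norm2 M.
Proof.
move=> /exists_unit_vector[x x1] [_ pM].
have := qform_le_norm2 M x; rewrite x1 expr1n mulr1; apply: lt_le_trans.
by apply: pM; rewrite -enorm_eq0 x1 oner_eq0.
Qed.

(** Coercivity without compactness: [x] is controlled by [M *m x] through the inverse, and [M *m x]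
    by the form through Cauchy-Schwarz. The added 1 only keeps the constant invertible. *)
Lemma psd_unit_ge n (M : 'M[R]_n) : psd M -> M \in unitmx ->
  exists2 c, 0 < c & forall x, c * enorm x ^+ 2 <= qform M x.
Proof.
move=> pM uM; have [a a0 ha] := enorm_mulmx_bound (invmx M).
have c0 : 0 < a * norm2 M + 1 by rewrite ltr_wpDl // mulr_ge0 // norm2_ge0.
exists (a * norm2 M + 1)^-1; first by rewrite invr_gt0.
move=> x; rewrite mulrC ler_pdivrMr // mulrC.
have := ha (M *m x); rewrite mulKmx // => /le_trans; apply.
have pMx : 0 <= qform M x by case: pM.
apply: (@le_trans _ _ (a * norm2 M * qform M x)).
  rewrite -mulrA ler_wpM2l // psd_enorm_mul_le ?norm2_ge0 //.
  exact: qform_le_norm2.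
by rewrite mulrDl mul1r lerDl.
Qed.

Lemma eigenvalue_qform n (M : 'M[R]_n) a : M^T = M -> eigenvalue M a ->
  exists2 x, x != 0 & qform M x = a * enorm x ^+ 2.
Proof.
move=> sM /eigenvalueP[v vM v0]; exists v^T; first by rewrite trmx_eq0.
by rewrite qformE -{1}sM -trmx_mul vM linearZ /= dotZr dotxx.
Qed.

(* The infimum of the Rayleigh quotient is an eigenvalue: otherwise the shifted
   form is positive semi-definite and non-singular, hence bounded below by a
   positive multiple of the squared norm. *)
Lemma rayleigh_eigenvalue n (M : 'M[R]_n) : (0 < n)%N -> M^T = M ->
  exists2 a, eigenvalue M a & forall x, a * enorm x ^+ 2 <= qform M x.
Proof.
move=> n0 sM; pose S := [set qform M x | x in [set x | enorm x = 1]].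
have S0 : S !=set0 by have [x x1] := exists_unit_vector n0; exists (qform M x); exists x.
have lS : has_lbound S.
  exists (- norm2 M) => _ [x /= x1 <-].
  have := qform_le_norm2 (- M) x; rewrite qformN x1 expr1n mulr1 lerNl.
  suff -> : norm2 (- M) = norm2 M by [].
  rewrite /norm2; congr sup; apply/seteqP.
  by split=> _ [y y1 <-]; exists (- y); rewrite /= ?mulmxN ?mulNmx ?opprK //;
     rewrite -scaleN1r enormZ normrN1 mul1r.
have ge_inf x : inf S * enorm x ^+ 2 <= qform M x.
  have [->|x0] := eqVneq x 0.
    by rewrite qform0x enorm0 // expr0n mulr0.
  have e0 := enorm_gt0 x0; rewrite -ler_pdivlMr ?exprn_gt0 //.
  apply: (@inf_lbound _ S) => //; exists ((enorm x)^-1 *: x) => /=.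
    by rewrite enormZ ger0_norm ?invr_ge0 ?(ltW e0) // mulVf ?gt_eqF.
  by rewrite qformZx exprVn mulrC.
exists (inf S) => //; apply: contraT => ninf.
pose N := M - (inf S)%:M.
have qN x : qform N x = qform M x - inf S * enorm x ^+ 2.
  by rewrite qformD qformN qform_scalar.
have pN : psd N.
  by split=> [|x]; rewrite ?qN ?subr_ge0 // linearB /= sM tr_scalar_mx.
have uN : N \in unitmx.
  rewrite -row_free_unit; apply: inj_row_free => v.
  rewrite mulmxBr mul_mx_scalar => /eqP; rewrite subr_eq0 => /eqP vM.
  move: ninf; apply: contraNeq => v0.
  by apply/eigenvalueP; exists v.
have [c c0 hc] := psd_unit_ge pN uN.
have : inf S + c <= inf S.
  apply: lb_le_inf => // _ [x /= x1 <-].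
  by have := hc x; rewrite qN x1 expr1n !mulr1 lerBrDl.
by rewrite gerDl leNgt c0.
Qed.

Lemma lambda_min_le n (M : 'M[R]_n) x : M^T = M ->
  lambda_min M * enorm x ^+ 2 <= qform M x.
Proof.
case: n M x => [|n] M x sM.
  by rewrite (flatmx0 x) qform0x enorm0 // expr0n mulr0.
have [a Ma ha] := rayleigh_eigenvalue (ltn0Sn n) sM.
apply: le_trans (ha x); apply: ler_wpM2r; first exact: sqr_ge0.
apply: inf_lbound => //; exists a => b /(eigenvalue_qform sM)[y y0 yb].
by have := ha y; rewrite yb ler_pM2r // exprn_gt0 // enorm_gt0.
Qed.

Lemma le_lambda_min n (M : 'M[R]_n) c : (0 < n)%N -> M^T = M ->
  (forall x, c * enorm x ^+ 2 <= qform M x) -> c <= lambda_min M.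
Proof.
move=> n0 sM h; have [a Ma _] := rayleigh_eigenvalue n0 sM.
apply: lb_le_inf; first by exists a.
move=> b /(eigenvalue_qform sM)[y y0 yb].
by have := h y; rewrite yb ler_pM2r // exprn_gt0 // enorm_gt0.
Qed.

End Norms.

(** * One step of the Riccati recursion *)

Section RiccatiStep.
Variables (R : realType) (n m : nat) (S : lqdata R n m) (t : nat).
Implicit Types (P X Y : 'M[R]_n) (x p l : 'cV[R]_n) (u : 'cV[R]_m).

Local Notation A := (lqA S t).
Local Notation B := (lqB S t).
Local Notation Q := (lqQ S t).
Local Notation Ru := (lqR S t).

Hypotheses (Q_pd : pd Q) (R_pd : pd Ru).

Definition gain P : 'M[R]_(m, n) := invmx (Ru + B^T *m P *m B) *m B^T *m P *m A.

Definition step_cost P x u : R :=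
  stage_cost S t x u + qform P (A *m x + B *m u).

Lemma hessian_pd P : psd P -> pd (Ru + B^T *m P *m B).
Proof. by move=> pP; apply: pdDl => //; apply: psd_cong. Qed.

Lemma riccati_sym P : psd P -> (riccati S t P)^T = riccati S t P.
Proof.
move=> pP; have [sG _] := hessian_pd pP; have [sP _] := pP; case: Q_pd => sQ _.
rewrite /riccati linearD /= sQ !trmx_mul trmxK linearB /= !trmx_mul trmxK sP.
by rewrite trmx_inv sG !mulmxA.
Qed.

(** Completion of the square in [u]. The minimality, monotonicity and scaling properties of
    [riccati] are read off from it. *)
Lemma step_costE P x u : psd P ->
  step_cost P x u = qform (riccati S t P) x
    + qform (Ru + B^T *m P *m B) (u + gain P *m x).
Proof.
move=> pP; have pG := hessian_pd pP; have uG := pd_unit pG.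
have [sP _] := pP; have [sG _] := pG.
set G := Ru + _ in pG uG sG *.
pose b := B^T *m (P *m (A *m x)).
have Kx : gain P *m x = invmx G *m b by rewrite /gain /b !mulmxA.
have -> : qform (riccati S t P) x
    = qform Q x + (qform P (A *m x) - dot b (invmx G *m b)).
  rewrite /riccati qformD qform_cong; congr (_ + _); rewrite qformD qformN.
  congr (_ - _); rewrite qformE -!mulmxA dot_mulmx sP dot_mulmx.
  by rewrite /b /G !mulmxA.

rewrite /step_cost /stage_cost (qform_add _ _ sP) (qform_add _ _ sG) Kx.
rewrite mulKVmx // -qform_inv // [qform (invmx G) b]qformE.
have -> : qform G u = qform Ru u + qform P (B *m u).
  by rewrite /G qformD qform_cong.
have -> : dot (A *m x) (P *m (B *m u)) = dot u b.
  by rewrite dot_sym // dotC dot_mulmx dotC.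
ring.
Qed.

Lemma riccati_le P x u : psd P -> qform (riccati S t P) x <= step_cost P x u.
Proof.
move=> pP; rewrite step_costE // lerDl.
by have [_] := pd_psd (hessian_pd pP); apply.
Qed.

Lemma riccati_attained P x : psd P ->
  step_cost P x (- (gain P *m x)) = qform (riccati S t P) x.
Proof. by move=> pP; rewrite step_costE // addNr qform0x addr0. Qed.

Lemma riccati_geQ P x : psd P -> qform Q x <= qform (riccati S t P) x.
Proof.
move=> pP; rewrite -riccati_attained // /step_cost /stage_cost -addrA lerDl.
by rewrite addr_ge0 //; [have [_] := pd_psd R_pd; apply | have [_] := pP; apply].
Qed.

Lemma riccati_pd P : psd P -> pd (riccati S t P).
Proof.
move=> pP; split=> [|x x0]; first exact: riccati_sym.
by apply: lt_le_trans (riccati_geQ x pP); case: Q_pd => _; apply.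
Qed.

Lemma riccati_mono P X : psd P -> psd X ->
  (forall x, qform P x <= qform X x) ->
  forall x, qform (riccati S t P) x <= qform (riccati S t X) x.
Proof.
move=> pP pX h x; rewrite -(riccati_attained x pX).
apply: le_trans (riccati_le x (- (gain X *m x)) pP) _.
by rewrite /step_cost lerD2l h.
Qed.

(** With the optimal input for [P] kept fixed, scaling by [c >= 1] multiplies only the cost of the
    next state and leaves the stage cost as it is. *)
Lemma riccatiZ_le P c x : psd P -> 1 <= c ->
  qform (riccati S t (c *: P)) x <= c * qform (riccati S t P) x.
Proof.
move=> pP c1; have c0 : 0 <= c by apply: le_trans c1.
have pcP : psd (c *: P).
  case: pP => sP pP; split=> [|y]; first by rewrite linearZ /= sP.
  by rewrite qformZ mulr_ge0.
rewrite -(riccati_attained x pP); apply: le_trans (riccati_le x (- (gain P *m x)) pcP) _.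
rewrite /step_cost qformZ mulrDr lerD2r ler_peMl // addr_ge0 //.
  by have [_] := pd_psd Q_pd; apply.
by have [_] := pd_psd R_pd; apply.
Qed.

(** With [y] the optimal next state and [P *m y] the costate, this and [gain_stationary] are the
    optimality conditions of the step in state and input. They provide the equality case of the
    duality below. *)
Lemma riccati_stationary P x : psd P ->
  riccati S t P *m x = Q *m x + A^T *m (P *m (A *m x - B *m (gain P *m x))).
Proof.
by move=> pP; rewrite /riccati /gain mulmxDl -!mulmxA !mulmxBl !mulmxBr !mulmxA.
Qed.

Lemma gain_stationary P x : psd P ->
  Ru *m (gain P *m x) = B^T *m (P *m (A *m x - B *m (gain P *m x))).
Proof.
move=> pP; have uG := pd_unit (hessian_pd pP).
apply: (addIr (B^T *m P *m B *m (gain P *m x))).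
rewrite -mulmxDl !mulmxBr !mulmxA subrK.
by rewrite mulmxV // mul1mx.
Qed.

(** The Lagrangian dual of [step_cost]: the sum of the conjugates of its three quadratic terms, [l]
    being the multiplier of the dynamics. *)
Definition dual_cost P p l : R :=
  qform (invmx Q) (p - A^T *m l) + qform (invmx Ru) (B^T *m l)
  + qform (invmx P) l.

Lemma riccati_inv_le P p l : pd P ->
  qform (invmx (riccati S t P)) p <= dual_cost P p l.
Proof.
move=> pP; have pP' := pd_psd pP; have pW := riccati_pd pP'.
set W := riccati S t P in pW *; have uW := pd_unit pW.
pose x := invmx W *m p; pose u := - (gain P *m x).
(* Weak duality. In the sum of the three inequalities the terms in [l] cancel through the dynamics,
   and [2 * dot p x - step_cost P x u] equals [qform (invmx W) p]. *)
have h1 := fenchel (p - A^T *m l) x Q_pd.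
have h2 := fenchel (B^T *m l) (- u) R_pd.
have h3 := fenchel l (A *m x + B *m u) pP.
have hW : step_cost P x u = qform (invmx W) p.
  by rewrite riccati_attained // -/W /x -qform_inv //; case: pW.
have hp : dot p x = qform (invmx W) p by rewrite qformE.
have e1 : dot (A^T *m l) x = dot l (A *m x) by rewrite dot_mulmx.
have e2 : dot (B^T *m l) u = dot l (B *m u) by rewrite dot_mulmx.
move: h1 h2 h3 hW hp; rewrite /dual_cost /step_cost /stage_cost.
rewrite dotBl dotNr dotDr e1 e2 qformNx.
lra.
Qed.

Lemma riccati_inv_attained P p : pd P ->
  exists l, qform (invmx (riccati S t P)) p = dual_cost P p l.
Proof.
move=> pP; have pP' := pd_psd pP; have pW := riccati_pd pP'.
set W := riccati S t P in pW *; have uW := pd_unit pW.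
pose x := invmx W *m p; pose v := gain P *m x; pose y := A *m x - B *m v.
(* At the costate of the optimal step all three Fenchel inequalities are equalities. *)
exists (P *m y); have hx : W *m x = p by rewrite mulKVmx.
have -> : qform (invmx W) p = step_cost P x (- v).
  by rewrite riccati_attained // -/W /x -qform_inv //; case: pW.
rewrite /step_cost /stage_cost /dual_cost mulmxN -/y fenchel_eq //.
rewrite -gain_stationary // -/v fenchel_eq // qformNx.
have -> : p - A^T *m (P *m y) = Q *m x.
  by rewrite -hx /W riccati_stationary // -/v -/y addrK.
by rewrite fenchel_eq.
Qed.

Definition eps_mx : 'M[R]_n :=
  invmx A *m B *m invmx (Ru + B^T *m invmx A^T *m Q *m invmx A *m B)
    *m B^T *m invmx A^T.

Definition zeta_mx : 'M[R]_n :=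
  Q + Q *m invmx A *m B *m invmx Ru *m B^T *m invmx A^T *m Q.

Lemma eps_hessian_pd : pd (Ru + B^T *m invmx A^T *m Q *m invmx A *m B).
Proof.
have := psd_cong (invmx A *m B) (pd_psd Q_pd).
by rewrite trmx_mul trmx_inv !mulmxA => /(pdDl R_pd).
Qed.

(** [eps_mx] is the parallel sum of [invmx Q] and [N *m invmx Ru *m N^T] with [N = invmx A *m B],
    that is, the part of [dual_cost] independent of [P], minimised over [l]. The lower bound is
    Fenchel's inequality at the pair [N *m g] and [g], where the multiplier [l] cancels. *)
Lemma eps_le_dual p l : A \in unitmx ->
  qform eps_mx p
    <= qform (invmx Q) (p - A^T *m l) + qform (invmx Ru) (B^T *m l).
Proof.
move=> uA; have pG := eps_hessian_pd; have uG := pd_unit pG.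
rewrite /eps_mx; set G := Ru + _ in pG uG *.
pose N := invmx A *m B; pose g := invmx G *m (N^T *m p).
have NT : N^T = B^T *m invmx A^T by rewrite trmx_mul trmx_inv.
have hE : qform (N *m invmx G *m N^T) p = qform G g.
  by rewrite -{1}[N]trmxK qform_cong qform_inv //; case: pG.
have h1 := fenchel (p - A^T *m l) (N *m g) Q_pd.
have h2 := fenchel (B^T *m l) g R_pd.
have hN : dot p (N *m g) = qform G g.
  by rewrite dot_mulmx qformE /g mulKVmx // dotC.
have hl : dot (A^T *m l) (N *m g) = dot (B^T *m l) g.
  by rewrite dot_mulmx NT -mulmxA mulKmx ?unitmx_tr.
have hG : qform G g = qform Ru g + qform Q (N *m g).
  by rewrite -(qform_cong Q N g) NT /N !mulmxA -qformD.
move: hE; rewrite NT /N !mulmxA => ->.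
move: h1 h2; rewrite dotBl hl hN hG; lra.
Qed.

(** The Woodbury formula for the inverse of [zeta_mx], checked by multiplying out. *)
Lemma invQ_eps_zeta : invmx Q = eps_mx + invmx zeta_mx.
Proof.
have uR := pd_unit R_pd; have uQ := pd_unit Q_pd.
have pG := eps_hessian_pd; have uG := pd_unit pG.
suff h : zeta_mx *m (invmx Q - eps_mx) = 1%:M.
  have [uZ _] := mulmx1_unit h.
  by rewrite -[invmx zeta_mx]mulmx1 -h mulKmx // addrC subrK.
rewrite /eps_mx /zeta_mx; set G := Ru + _ in pG uG *.
pose N := invmx A *m B; pose N' := B^T *m invmx A^T.
have -> : Q + Q *m invmx A *m B *m invmx Ru *m B^T *m invmx A^T *m Q
  = Q + Q *m N *m invmx Ru *m N' *m Q by rewrite /N /N' !mulmxA.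
have -> : invmx A *m B *m invmx G *m B^T *m invmx A^T = N *m invmx G *m N'.
  by rewrite /N /N' !mulmxA.
have hG : N' *m Q *m N = G - Ru by rewrite /G /N /N' !mulmxA addrC addKr.
rewrite mulmxDl !mulmxBr mulmxV // -[_ *m Q *m invmx Q]mulmxA mulmxV // mulmx1.
have -> : Q *m N *m invmx Ru *m N' *m Q *m (N *m invmx G *m N')
   = Q *m N *m invmx Ru *m (N' *m Q *m N) *m invmx G *m N' by rewrite !mulmxA.
rewrite hG mulmxBr mulmxKV // !mulmxBl mulmxK //.
by rewrite subKr !mulmxA subrK.
Qed.

End RiccatiStep.

(** Convexity of the exponential between [- s] and [0]: the tangent inequalities at [- (g * s)]
    towards the two end points, with weights [g] and [1 - g]. *)
Lemma expR_convex_neg (R : realType) (g s : R) : 0 <= g <= 1 ->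
  expR (- (g * s)) <= 1 - g + g * expR (- s).
Proof.
move=> /andP[g0 g1]; set y := - (g * s).
have e0 : 0 < expR y by exact: expR_gt0.
have h1 := expR_ge1Dx (- y).
have h2 := expR_ge1Dx (- s - y).
have e1 : expR y * expR (- y) = 1 by rewrite -expRD subrr expR0.
have e2 : expR y * expR (- s - y) = expR (- s) by rewrite -expRD addrC subrK.
have {h1}h1 := ler_wpM2l (ltW e0) h1; have {h2}h2 := ler_wpM2l (ltW e0) h2.
rewrite e1 in h1; rewrite e2 in h2.
have {}h1 := ler_wpM2l (_ : 0 <= 1 - g) h1; have {}h2 := ler_wpM2l g0 h2.
have : (1 - g) * (expR y * (1 - y)) + g * (expR y * (1 + (- s - y))) = expR y.
  by rewrite /y; ring.
have := h1 ltac:(by rewrite subr_ge0); lra.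
Qed.

(* In terms of inverses, the Riccati map is [dual_cost] minimised over [l], a
   sum of the fixed part [invmx Q + invmx R >= eps_mx] and of [invmx P]; scaling
   only the latter by [expR (- s)] scales the whole by at least
   [1 - g + g * expR (- s)], since [invmx Q - eps_mx = invmx zeta_mx] bounds the
   share of the varying part by [g = zeta / (zeta + eps)]. *)
Lemma riccati_contraction (R : realType) n m (S : lqdata R n m) t
    (P X : 'M[R]_n) (zeta eps s : R) :
  pd (lqQ S t) -> pd (lqR S t) -> lqA S t \in unitmx -> pd P -> pd X ->
  0 < zeta -> 0 < eps -> 0 <= s ->
  (forall p, qform (invmx (zeta_mx S t)) p <= zeta * enorm p ^+ 2) ->
  (forall p, eps * enorm p ^+ 2 <= qform (eps_mx S t) p) ->
  (forall x, qform X x <= expR s * qform P x) ->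
  forall x, qform (riccati S t X) x
    <= expR (zeta / (zeta + eps) * s) * qform (riccati S t P) x.
Proof.
move=> pQ pR uA pP pX z0 e0 s0 hz he hXP.
have pW := riccati_pd pQ pR (pd_psd pP); have pV := riccati_pd pQ pR (pd_psd pX).
set W := riccati S t P in pW *; set V := riccati S t X in pV *.
set g := zeta / (zeta + eps).
have ze0 : 0 < zeta + eps by exact: addr_gt0.
have g01 : 0 <= g <= 1.
  by apply/andP; split; rewrite /g ?ler_pdivrMr ?mul1r ?lerDl ?divr_ge0 ?ltW.
have WQ p : qform (invmx W) p <= qform (invmx (lqQ S t)) p.
  rewrite -[X in X <= _]mul1r; apply: inv_le_scale => // x.
  by rewrite mul1r riccati_geQ //; exact: pd_psd.
have share p : (1 - g) * qform (invmx W) p <= qform (eps_mx S t) p.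
  have -> : 1 - g = eps / (zeta + eps) by rewrite /g; field; rewrite gt_eqF.
  rewrite mulrAC ler_pdivrMr // mulrDr.
  apply: le_trans (ler_wpM2l (ltW e0) (WQ p)) _.
  rewrite (invQ_eps_zeta pQ pR) qformD mulrDr addrC [eps * qform (eps_mx _ _) p]mulrC.
  rewrite lerD2r; apply: le_trans (ler_wpM2l (ltW e0) (hz p)) _.
  by rewrite mulrCA [_ * zeta]mulrC ler_wpM2l // ltW.
have key p : (expR (g * s))^-1 * qform (invmx W) p <= qform (invmx V) p.
  have [l ->] := riccati_inv_attained pQ pR p pX.
  have hD := eps_le_dual pQ pR p l uA; have hW := riccati_inv_le pQ pR p l pP.
  have hl : (expR s)^-1 * qform (invmx P) l <= qform (invmx X) l.
    apply: inv_le_scale => // [|x]; first by rewrite invr_gt0 expR_gt0.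
    by rewrite mulrC ler_pdivrMr ?expR_gt0 // mulrC.
  have a1 : (expR s)^-1 <= 1 by rewrite invf_le1 ?expR_gt0 // -expR0 ler_expR.
  have a0 : 0 < (expR s)^-1 by rewrite invr_gt0 expR_gt0.
  have := expR_convex_neg s g01; rewrite !expRN.
  have w0 : 0 <= qform (invmx W) p by have [_] := pd_psd (pd_inv pW); apply.
  move=> /(ler_wpM2r w0) /le_trans; apply.
  have := share p; move: hW hl hD; rewrite /dual_cost.
  set w := qform _ p; set a := (expR s)^-1 in a0 a1 *.
  set D := qform (invmx (lqQ S t)) _ + qform _ _; set Pl := qform (invmx P) l; set Xl := qform (invmx X) l.
  set E := qform _ p => hW hl hD hs.
  (* [D] is split as [a * D + (1 - a) * D]: the first piece joins [a * Pl] to give [a] times the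
     dual bound, the second is estimated by [share]. The weights of [w] add up to
     [1 - g + g * a]. *)
  have h1 : a * w <= a * D + a * Pl by rewrite -mulrDr ler_wpM2l // ltW.
  have h2 : (1 - a) * ((1 - g) * w) <= (1 - a) * D.
    by rewrite ler_wpM2l ?subr_ge0 // (le_trans hs hD).
  move: h1 h2 hl; lra.
move=> x; rewrite mulrC -ler_pdivrMr ?expR_gt0 // mulrC.
have := inv_le_scale (pd_inv pW) (pd_inv pV) _ key x.
by rewrite !invmxK invr_gt0 expR_gt0; apply.
Qed.

(** * The receding-horizon policy *)

Section RecedingHorizon.
Variables (R : realType) (n m : nat) (S : lqdata R n m).
Implicit Types (X Y : 'M[R]_n) (x : 'cV[R]_n) (u : nat -> 'cV[R]_m).

Hypotheses (Q_pd : forall t, pd (lqQ S t)) (R_pd : forall t, pd (lqR S t)).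
Hypothesis BB_unit : forall t, lqB S t *m (lqB S t)^T \in unitmx.

Definition deadbeat t : 'M[R]_(m, n) :=
  (lqB S t)^T *m invmx (lqB S t *m (lqB S t)^T) *m lqA S t.

Lemma deadbeat_reaches0 t x :
  lqA S t *m x + lqB S t *m (- (deadbeat t *m x)) = 0.
Proof. by rewrite mulmxN /deadbeat !mulmxA mulmxV // mul1mx subrr. Qed.

Lemma XtermE t :
  Xterm S t = lqQ S t + (deadbeat t)^T *m lqR S t *m deadbeat t.
Proof.
rewrite /Xterm /deadbeat !trmx_mul trmxK trmx_inv trmx_mul trmxK.
by rewrite !mulmxA.
Qed.

Lemma qform_Xterm t x :
  qform (Xterm S t) x = stage_cost S t x (- (deadbeat t *m x)).
Proof. by rewrite XtermE qformD qform_cong /stage_cost qformNx. Qed.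

Lemma Xterm_pd t : pd (Xterm S t).
Proof. by rewrite XtermE; apply: pdDl => //; apply/psd_cong/pd_psd. Qed.

Lemma riccati_le_Xterm t Y x : psd Y ->
  qform (riccati S t Y) x <= qform (Xterm S t) x.
Proof.
move=> pY; apply: le_trans (riccati_le (R_pd t) x (- (deadbeat t *m x)) pY) _.
by rewrite /step_cost deadbeat_reaches0 qform0x addr0 qform_Xterm.
Qed.

Lemma riccati_comp_pd t j X : pd X -> pd (riccati_comp S t j X).
Proof.
by elim: j t => //= j IH t pX; apply/riccati_pd => //; apply/pd_psd/IH.
Qed.

Lemma riccati_comp_mono t j X Y : pd X -> pd Y ->
  (forall x, qform X x <= qform Y x) ->
  forall x, qform (riccati_comp S t j X) x <= qform (riccati_comp S t j Y) x.
Proof.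
move=> pX pY; elim: j t => //= j IH t h x.
by apply: riccati_mono => //; [exact/pd_psd/riccati_comp_pd .. | exact: IH].
Qed.

Lemma riccati_compSr t j X :
  riccati_comp S t j.+1 X = riccati_comp S t j (riccati S (t + j) X).
Proof.
elim: j t => [|j IH] t; first by rewrite addn0.
by rewrite [LHS]/= -/(riccati_comp S t.+1 j.+1 X) IH addSnnS.
Qed.

Lemma riccati_comp_contraction (P : nat -> 'M[R]_n) (zeta eps s : R) t j X :
  (forall t, lqA S t \in unitmx) -> (forall t, pd (P t)) ->
  (forall t, P t = riccati S t (P t.+1)) -> pd X ->
  0 < zeta -> 0 < eps -> 0 <= s ->
  (forall t p, qform (invmx (zeta_mx S t)) p <= zeta * enorm p ^+ 2) ->
  (forall t p, eps * enorm p ^+ 2 <= qform (eps_mx S t) p) ->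
  (forall x, qform X x <= expR s * qform (P (t + j)%N) x) ->
  forall x, qform (riccati_comp S t j X) x
    <= expR ((zeta / (zeta + eps)) ^+ j * s) * qform (P t) x.
Proof.
move=> uA pP rP pX z0 e0 s0 hz he; elim: j t => [|j IH] t hX x.
  by rewrite expr0 mul1r; move: (hX x); rewrite addn0.
rewrite rP exprS -mulrA; apply: riccati_contraction => //.
- exact: riccati_comp_pd.
- by rewrite mulr_ge0 // exprn_ge0 // divr_ge0 ?ltW // addr_gt0.
- by apply: IH => y; rewrite addSnnS.
Qed.

(** * Dynamic programming over a finite horizon *)

Definition horizon_cost T t x u X : R :=
  \sum_(j < T) stage_cost S (t + j) (traj S t x u j) (u j)
  + qform X (traj S t x u T).

Lemma traj_shift t x u j :
  traj S t x u j.+1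
  = traj S t.+1 (lqA S t *m x + lqB S t *m u 0%N) (u \o succn) j.
Proof.
elim: j => [|j IH]; first by rewrite /= addn0.
by rewrite [LHS]/= -/(traj S t x u j.+1) IH /= addSnnS.
Qed.

Lemma traj_ext t x u v T : (forall j, (j < T)%N -> u j = v j) ->
  forall j, (j <= T)%N -> traj S t x u j = traj S t x v j.
Proof.
move=> uv; elim=> //= j IH jT; rewrite IH ?(ltnW jT) //.
by rewrite uv.
Qed.

Lemma horizon_cost_ext T t x u v X : (forall j, (j < T)%N -> u j = v j) ->
  horizon_cost T t x u X = horizon_cost T t x v X.
Proof.
move=> uv; rewrite /horizon_cost; congr (_ + qform X _).
  by apply: eq_bigr => j _; rewrite (traj_ext _ _ uv) ?uv // ltnW.
exact: (traj_ext _ _ uv).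
Qed.

Lemma horizon_costS T t x u X :
  horizon_cost T.+1 t x u X = stage_cost S t x (u 0%N)
    + horizon_cost T t.+1 (lqA S t *m x + lqB S t *m u 0%N) (u \o succn) X.
Proof.
rewrite /horizon_cost big_ord_recl /= addn0 -addrA; congr (_ + _).
rewrite -/(traj S t x u T.+1) traj_shift; congr (_ + _).
apply: eq_bigr => j _; rewrite -[bump 0 j]/(j.+1) -/(traj S t x u j.+1).
by rewrite traj_shift addSnnS.
Qed.

Lemma horizon_cost_ge T t x u X : pd X ->
  qform (riccati_comp S t T X) x <= horizon_cost T t x u X.
Proof.
move=> pX; elim: T t x u => [|T IH] t x u.
  by rewrite /horizon_cost big_ord0 add0r.
rewrite horizon_costS /=.
have pY := pd_psd (riccati_comp_pd t.+1 T pX).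
apply: le_trans (riccati_le (R_pd t) x (u 0%N) pY) _.
by rewrite /step_cost lerD2l IH.
Qed.

Lemma horizon_cost_attained T t x X : pd X ->
  exists u, horizon_cost T t x u X = qform (riccati_comp S t T X) x.
Proof.
move=> pX; elim: T t x => [|T IH] t x.
  by exists (fun=> 0); rewrite /horizon_cost big_ord0 add0r.
have pY := pd_psd (riccati_comp_pd t.+1 T pX).
set Y := riccati_comp S t.+1 T X in pY.
pose u0 := - (gain S t Y *m x).
have [u hu] := IH t.+1 (lqA S t *m x + lqB S t *m u0).
exists (fun j => if j is j'.+1 then u j' else u0).
rewrite horizon_costS /=.
by rewrite -(riccati_attained (R_pd t) x pY) /step_cost -hu.
Qed.

Lemma rh_argmin_cost T t x X : pd X ->
  horizon_cost T t x (fun j => (rh_argmin S T t x X)`_j) X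
  = qform (riccati_comp S t T X) x.
Proof.
move=> pX; apply/eqP; rewrite eq_le horizon_cost_ge // andbT.
have [u hu] := horizon_cost_attained T t x pX.
have uE : horizon_cost T t x (fun j => (mktuple (fun i : 'I_T => u i))`_j) X
          = qform (riccati_comp S t T X) x.
  rewrite -hu; apply: horizon_cost_ext => j jT.
  by rewrite -[j]/(val (Ordinal jT)) nth_mktuple.
(* The default value of [xget] is ruled out: the tuple made of the first [T] optimal inputs is
   itself a minimiser. *)
rewrite -uE /rh_argmin; case: xgetP => [w -> /(_ (mktuple (fun i : 'I_T => u i)))//|].
move=> /(_ (mktuple (fun i : 'I_T => u i))) []; move=> w.
rewrite [X in X <= _]uE; exact: horizon_cost_ge.
Qed.

Variable T : nat.
Hypothesis T_gt0 : (0 < T)%N.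

Local Notation W t := (riccati S t (Xhat S T t)).
Local Notation mu := (rh_policy S T (Xterm S)).

Lemma Xhat_pd t : pd (Xhat S T t).
Proof. exact/riccati_comp_pd/Xterm_pd. Qed.

Lemma riccati_Xhat_pd t : pd (W t).
Proof. exact/riccati_pd/pd_psd/Xhat_pd. Qed.

Lemma riccati_XhatE t : W t = riccati_comp S t T (Xterm S (t + T)).
Proof. by case: T T_gt0. Qed.

(** Both sides apply the same T - 1 operators from time [t.+1] on. Inside them stands
    [riccati S (t + T)] of the next terminal penalty on the left and [Xterm S (t + T)] on the right,
    so the dead-beat bound and monotonicity suffice. *)
Lemma riccati_Xhat_le_prev t x : qform (W t.+1) x <= qform (Xhat S T t) x.
Proof.
rewrite riccati_XhatE -{1}(prednK T_gt0) riccati_compSr /Xhat.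
apply: riccati_comp_mono => [||y]; last first.
- rewrite addSnnS prednK //; apply: riccati_le_Xterm.
  exact/pd_psd/Xterm_pd.
- exact: Xterm_pd.
- exact/riccati_pd/pd_psd/Xterm_pd.
Qed.

(** [qform (W t) x] is the cost of the whole minimising tuple. After its first input, the remaining
    T - 1 inputs cost at least the value of [Xhat S T t] at the state reached. *)
Lemma rh_policy_decrease t x :
  stage_cost S t x (mu t x)
    + qform (Xhat S T t) (lqA S t *m x + lqB S t *m mu t x)
  <= qform (W t) x.
Proof.
rewrite riccati_XhatE -rh_argmin_cost; last exact: Xterm_pd.
rewrite -[T in horizon_cost T](prednK T_gt0) horizon_costS /rh_policy lerD2l.
exact/horizon_cost_ge/Xterm_pd.
Qed.

Lemma traj_closed_loop xi t :
  traj S 0 xi (policy_input S mu xi) t = closed_loop S mu xi t.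
Proof. by elim: t => //= t ->; rewrite add0n. Qed.

Lemma rh_partial_cost xi N :
  \sum_(0 <= t < N) stage_cost S t (traj S 0 xi (policy_input S mu xi) t)
     (policy_input S mu xi t)
  + qform (W N) (closed_loop S mu xi N) <= qform (W 0%N) xi.
Proof.
elim: N => [|N IH]; first by rewrite big_geq // add0r.
apply: le_trans IH; rewrite big_nat_recr //= -addrA lerD2l traj_closed_loop.
apply: le_trans (rh_policy_decrease N (closed_loop S mu xi N)).
by rewrite /policy_input lerD2l riccati_Xhat_le_prev.
Qed.

Lemma stage_cost_ge0 t x v : 0 <= stage_cost S t x v.
Proof.
by rewrite addr_ge0 //; [have [_] := pd_psd (Q_pd t); apply
                        |have [_] := pd_psd (R_pd t); apply].
Qed.

Lemma partial_cost_homo xi u :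
  {homo (fun N => (\sum_(0 <= t < N) stage_cost S t (traj S 0 xi u t) (u t))%:E)
    : i j / (i <= j)%N >-> (i <= j)%E}.
Proof.
move=> i j ij; rewrite lee_fin [X in _ <= X](big_cat_nat (n := i)) //= lerDl.
by apply: sumr_ge0 => t _; exact: stage_cost_ge0.
Qed.

Lemma total_cost_rh_le xi :
  (total_cost S xi (policy_input S mu xi) <= (qform (W 0%N) xi)%:E)%E.
Proof.
apply: lime_le; first exact/ereal_nondecreasing_is_cvgn/partial_cost_homo.
near=> N; rewrite lee_fin; apply: le_trans (rh_partial_cost xi N).
by rewrite lerDl; have [_] := pd_psd (riccati_Xhat_pd N); apply.
Unshelve. all: by end_near. Qed.

(** * The optimal infinite-horizon cost and the performance loss *)

Section OptimalValue.
Variables (P : nat -> 'M[R]_n) (c q : R).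
Hypotheses (P_pd : forall t, pd (P t)) (P_rec : forall t, P t = riccati S t (P t.+1)).
Hypotheses (q_gt0 : 0 < q) (c_ge0 : 0 <= c).
Hypothesis P_le : forall t x, qform (P t) x <= c * enorm x ^+ 2.
Hypothesis Q_ge : forall t x, q * enorm x ^+ 2 <= qform (lqQ S t) x.

Lemma partial_cost_ge xi u N :
  qform (P 0%N) xi
  <= \sum_(0 <= t < N) stage_cost S t (traj S 0 xi u t) (u t)
     + qform (P N) (traj S 0 xi u N).
Proof.
elim: N => [|N IH]; first by rewrite big_geq // add0r.
apply: le_trans IH _; rewrite big_nat_recr //= -addrA lerD2l P_rec.
exact: (riccati_le (R_pd N)) (pd_psd (P_pd N.+1)).
Qed.

Lemma terminal_le_stage xi u N :
  qform (P N) (traj S 0 xi u N)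
  <= c / q * stage_cost S N (traj S 0 xi u N) (u N).
Proof.
apply: le_trans (P_le _ _) _; rewrite -mulrA ler_wpM2l // mulrC ler_pdivlMr //.
rewrite mulrC; apply: le_trans (Q_ge N _) _; rewrite /stage_cost lerDl.
by have [_] := pd_psd (R_pd N); apply.
Qed.

(* Along an input of finite cost the stage costs tend to 0, hence so do the
   values of [P], which the stage costs dominate. *)
Lemma total_cost_ge xi u : ((qform (P 0%N) xi)%:E <= total_cost S xi u)%E.
Proof.
have hom := partial_cost_homo xi u.
have cv := ereal_nondecreasing_is_cvgn hom.
set s := fun N : nat => \sum_(0 <= t < N) stage_cost S t (traj S 0 xi u t) (u t).
have s_le N : ((s N)%:E <= total_cost S xi u)%E.
  by have := ereal_nondecreasing_cvgn hom; rewrite /total_cost => /cvg_lim ->//; apply: ereal_sup_ubound; exists N.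
case E : (total_cost S xi u) => [L| |]; last first.
- by have := s_le 0%N; rewrite E.
- by rewrite leey.
rewrite lee_fin leNgt; apply/negP => LP.
have sL N : s N <= L by have := s_le N; rewrite E lee_fin.
(* The gap [e] bounds every terminal value of [P] from below, hence every stage cost up to the
   factor [c / q]; the partial sums then grow linearly and exceed [L]. *)
pose e := qform (P 0%N) xi - L; have e0 : 0 < e by rewrite subr_gt0.
have stage_ge N : e <= c / q * stage_cost S N (traj S 0 xi u N) (u N).
  apply: le_trans (terminal_le_stage xi u N).
  by have := partial_cost_ge xi u N; have := sL N; rewrite /e /s; lra.
(* Only [0 <= c] is assumed; [c = 0] would force [e <= 0]. *)
have cq0 : 0 < c / q.
  rewrite lt_def divr_ge0 ?(ltW q_gt0) // andbT; apply/eqP => cq.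
  by have := stage_ge 0%N; rewrite cq mul0r leNgt e0.
have s_ge N : N%:R * (e / (c / q)) <= s N.
  elim: N => [|N IH]; first by rewrite /s big_geq // mul0r.
  rewrite /s big_nat_recr //= -/(s N) -natr1 mulrDl mul1r lerD //.
  by rewrite ler_pdivrMr // mulrC.
have k0 : 0 < e / (c / q) by rewrite divr_gt0.
have [N hN] : exists N : nat, L / (e / (c / q)) < N%:R.
  exists (Num.bound `|L / (e / (c / q))|).
  exact: le_lt_trans (ler_norm _) (archi_boundP (normr_ge0 _)).
have := le_trans (s_ge N) (sL N).
by rewrite -ler_pdivlMr // leNgt hN.
Qed.

(** The comparison is made at time 1, after the T - 1 inner operators; the outermost one carries the
    factor [1 + b] to time 0 by monotonicity and [riccatiZ_le]. *)
Lemma perf_loss_le b xi : 0 <= b ->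
  (forall x, qform (Xhat S T 0) x <= (1 + b) * qform (P 1%N) x) ->
  (perf_loss S mu xi <= (b * qform (P 0%N) xi)%:E)%E.
Proof.
move=> b0 hX.
have hW : qform (W 0%N) xi <= (1 + b) * qform (P 0%N) xi.
  have b1 : 1 <= 1 + b by rewrite lerDl.
  have pP1 := pd_psd (P_pd 1).
  rewrite P_rec; apply: le_trans (riccatiZ_le (Q_pd 0) (R_pd 0) xi pP1 b1).
  apply: riccati_mono => // [||y]; last by rewrite qformZ.
  - exact/pd_psd/Xhat_pd.
  - case: pP1 => sP pP; split=> [|y]; first by rewrite linearZ /= sP.
    by rewrite qformZ mulr_ge0 // (le_trans ler01).
rewrite /perf_loss.
have -> : b * qform (P 0%N) xi
    = (1 + b) * qform (P 0%N) xi - qform (P 0%N) xi by ring.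
rewrite EFinB; apply: leeB.
  by apply: le_trans (total_cost_rh_le xi) _; rewrite lee_fin.
by apply: le_ereal_inf_tmp => _ [u _ <-]; exact: total_cost_ge.
Qed.

End OptimalValue.

End RecedingHorizon.

(** * The determinant of the lifted dynamics *)

Section Determinants.
Variable R : realType.

(** The two block eliminations of the matrix with unit diagonal blocks and off-diagonal blocks [U]
    and [V]. *)
Lemma det_sylvester m n (U : 'M[R]_(m, n)) (V : 'M[R]_(n, m)) :
  \det (1%:M - U *m V) = \det (1%:M - V *m U).
Proof.
have h1 : block_mx 1%:M (- U) 0 1%:M *m block_mx 1%:M U V 1%:M
    = block_mx (1%:M - U *m V) 0 V 1%:M.
  rewrite mulmx_block !mul1mx !mul0mx !mulmx1 mulNmx !add0r.
  by rewrite subrr.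
have h2 : block_mx 1%:M 0 (- V) 1%:M *m block_mx 1%:M U V 1%:M
    = block_mx 1%:M U 0 (1%:M - V *m U).
  rewrite mulmx_block !mul1mx !mul0mx !mulmx1 mulNmx !addr0.
  by rewrite addNr addrC.
have := congr1 determinant h1; have := congr1 determinant h2.
rewrite !det_mulmx !det_ublock !det_lblock !det1 !mulr1 !mul1r => -> <-.
by [].
Qed.

Lemma det_feedback m n p (F : 'M[R]_n) (G : 'M[R]_(n, m)) (H : 'M[R]_m)
    (K : 'M[R]_(m, p)) (L : 'M[R]_(p, n)) : F \in unitmx -> H \in unitmx ->
  \det H * \det (F - G *m invmx H *m K *m L)
    = \det F * \det (H - K *m L *m invmx F *m G).
Proof.
move=> uF uH.
have -> : F - G *m invmx H *m K *m L
    = F *m (1%:M - (invmx F *m G) *m (invmx H *m K *m L)).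
  by rewrite mulmxBr mulmx1 !mulmxA mulmxV // mul1mx.
rewrite det_mulmx det_sylvester mulrCA; congr (_ * _); rewrite -det_mulmx.
by rewrite mulmxBr mulmx1 !mulmxA mulmxV // mul1mx.
Qed.

Lemma gram_sum_rows m n (D : 'M[R]_(m, n)) :
  D^T *m D = \sum_i (row i D)^T *m row i D.
Proof.
apply/matrixP => k l; rewrite mxE summxE; apply: eq_bigr => i _.
by rewrite mxE [RHS]mxE big_ord1 !mxE.
Qed.

(** The Gram matrix is added one row of [D] at a time: each rank-one update multiplies the
    determinant by [1 + v *m invmx N *m v^T], which is at least 1. *)
Lemma det_pd_gram m n (M : 'M[R]_n) (D : 'M[R]_(m, n)) : pd M ->
  `|\det M| <= `|\det (M + D^T *m D)|.
Proof.
move=> pM; rewrite gram_sum_rows.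
suff [] : pd (M + \sum_i (row i D)^T *m row i D) /\
  `|\det M| <= `|\det (M + \sum_i (row i D)^T *m row i D)| by [].
elim/big_rec: _ => [|i Z _ [pZ hZ]]; first by rewrite addr0.
rewrite addrCA addrC; split; first exact: pdDl (psd_gram _).
apply: le_trans hZ _; set N := M + Z in pZ *; set v := row i D.
have uN := pd_unit pZ.
have -> : N + v^T *m v = N *m (1%:M - (- (invmx N *m v^T)) *m v).
  by rewrite mulNmx opprK mulmxDr mulmx1 !mulmxA mulmxV // mul1mx.
rewrite det_mulmx det_sylvester normrM ler_peMr //.
rewrite mulmxN opprK det_mx11 mxE [1%:M _ _]mxE eqxx.
have h : 0 <= (v *m (invmx N *m v^T)) ord0 ord0.
  have [_ /(_ v^T)] := pd_psd (pd_inv pZ).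
  by rewrite /qform trmxK mulmxA.
by rewrite ger0_norm ?lerDl // addr_ge0.
Qed.

(* Support on the block upper triangle: [f] and [g] give the block indices of
   the rows and columns, and [a = 1] excludes the diagonal blocks. *)
Definition upper m n (f : 'I_m -> nat) (g : 'I_n -> nat) (a : nat)
  (M : 'M[R]_(m, n)) := forall i j, M i j != 0 -> (f i + a <= g j)%N.

Lemma upperM m n p f g h a b (M : 'M[R]_(m, n)) (N : 'M[R]_(n, p)) :
  upper f g a M -> upper g h b N -> upper f h (a + b) (M *m N).
Proof.
move=> uM uN i j; rewrite mxE => /eqP s0; apply: contra_notT s0 => fh.
rewrite big1 // => k _; apply/eqP; rewrite mulf_eq0; apply: contraNT fh.
rewrite negb_or => /andP[/uM h1 /uN h2]; rewrite addnA.
by apply: leq_trans h2; rewrite leq_add2r.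
Qed.

Lemma upperN m n f g a (M : 'M[R]_(m, n)) : upper f g a M -> upper f g a (- M).
Proof. by move=> uM i j; rewrite mxE oppr_eq0; exact: uM. Qed.

(** Replaces powers of a nilpotent [D]: row [i] of [X] involves row [i] of [Y] and rows of [X] of
    strictly larger level, so the support is found by induction downwards from the maximal level
    [K]. *)
Lemma upper_fix m n f g a (D : 'M[R]_m) (X Y : 'M[R]_(m, n)) :
  upper f f 1 D -> upper f g a Y -> X = Y + D *m X -> upper f g a X.
Proof.
move=> uD uY XE; pose K := \max_i f i.
suff h k i j : (K < f i + k)%N -> X i j != 0 -> (f i + a <= g j)%N.
  by move=> i j; apply: (h K.+1); rewrite addnS ltnS leq_addl.
elim: k i => [|k IH] i Ki.
  by move: Ki; rewrite addn0 ltnNge leq_bigmax.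
rewrite XE mxE => s0; rewrite leqNgt; apply/negP => gf.
case/negP: s0; rewrite addr_eq0.
have -> : Y i j = 0 by apply/eqP; apply: contraLR gf; rewrite -leqNgt; exact: uY.
rewrite eq_sym oppr_eq0 mxE big1 // => l _.
apply/eqP; rewrite mulf_eq0; apply: contraLR gf; rewrite negb_or -leqNgt.
move=> /andP[/uD fl Xl]; apply: leq_trans (IH l _ Xl).
  by rewrite leq_add2r (leq_trans _ fl) // leq_addr.
by apply: leq_trans Ki _; rewrite addnS -addSn leq_add2r -addn1.
Qed.

Lemma upper_fix0 m n f (D : 'M[R]_m) (X : 'M[R]_(m, n)) :
  upper f f 1 D -> X = D *m X -> X = 0.
Proof.
move=> uD XE; apply/matrixP => i j; rewrite mxE; apply/eqP; apply: contraT.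
(* With all columns put at level 0, a nonzero entry would have a row level at most -1. *)
have : upper f (fun _ : 'I_n => 0%N) 1 X.
  apply: upper_fix uD (_ : upper _ _ _ 0) _; last by rewrite add0r.
  by move=> ? ?; rewrite mxE eqxx.
by move=> /[apply]; rewrite addn1.
Qed.

Lemma det_upper m (f : 'I_m -> nat) (U : 'M[R]_m) :
  (forall i j : 'I_m, (i <= j)%N -> (f i <= f j)%N) -> upper f f 1 U ->
  \det (1%:M + U) = 1.
Proof.
move=> fm uU; have U0 (i j : 'I_m) : (i <= j)%N -> U j i = 0.
  move=> ij; apply/eqP; apply: contraT => /uU.
  by rewrite addn1 ltnNge fm.
rewrite -det_tr det_trig ?big1 // => [i _|].
  by rewrite !mxE eqxx U0 // addr0.
apply/is_trig_mxP => i j ij; rewrite !mxE U0 ?(ltnW ij) // addr0.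
by rewrite -val_eqE gtn_eqF.
Qed.

End Determinants.

(** * Causality of the lifted maps and the determinant identity *)

Section Lifting.
Variables (R : realType) (n m : nat) (S : lqdata R n m) (d t : nat).
Hypotheses (A_unit : forall k, lqA S k \in unitmx)
  (R_pd : forall k, pd (lqR S k)).

Local Notation lvl := (fun i : 'I_(\sum_(i < d.+1) n) => val (tagnat.sig1 i)).
Local Notation lvl_out := (fun i : 'I_(\sum_(i < d) n) => val (tagnat.sig1 i)).
(** Input block [j] acts on state block [j + 1]. This shift puts both on the same level and makes
    [liftB] diagonal for the levels. *)
Local Notation lvl_in := (fun i : 'I_(\sum_(i < d) m) => (val (tagnat.sig1 i)).+1).
Local Notation sel := (sel_last R n d).
Local Notation inj := (inj_first R n d).
Local Notation Ahat := (liftA S d t).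
Local Notation Phi := (liftPhi S d t).
Local Notation Gamma := (liftGamma S d t).
Local Notation Xi := (liftXi S d t).
Local Notation Delta := (liftDelta S d t).

Let D : 'M[R]_(\sum_(i < d.+1) n) := \mxblock_(i < d.+1, j < d.+1)
  (if i == j.+1 :> nat then lqA S (d * t + j) else 0).
Let Dinv : 'M[R]_(\sum_(i < d.+1) n) := \mxblock_(i < d.+1, j < d.+1)
  (if j == i.+1 :> nat then invmx (lqA S (d * t + i)) else 0).

Lemma shift_upper : upper lvl lvl 1 D^T.
Proof.
move=> i j /=; rewrite !mxE; case: ifP => [/eqP ->|]; first by rewrite addn1.
by rewrite mxE eqxx.
Qed.

Lemma unshift_upper : upper lvl lvl 1 Dinv.
Proof.
move=> i j /=; rewrite !mxE; case: ifP => [/eqP ->|]; first by rewrite addn1.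
by rewrite mxE eqxx.
Qed.

Lemma sig1_homo p (p_ : 'I_p -> nat) (i j : 'I_(\sum_(i < p) p_ i)) :
  (i <= j)%N -> (tagnat.sig1 i <= tagnat.sig1 j)%N.
Proof. by move=> ij; have := tagnat.le_sig1 ij. Qed.

Lemma det_liftA : \det Ahat = 1.
Proof.
rewrite -det_tr /liftA -/D linearB /= trmx1.
apply: (@det_upper _ _ lvl) => [i j|]; first exact: sig1_homo.
exact/upperN/shift_upper.
Qed.

Lemma liftA_unit : Ahat \in unitmx.
Proof. by rewrite unitmxE det_liftA unitr1. Qed.

(** Causality of the forward dynamics: the transpose [X] of the inverse solves
    [X = 1%:M + D^T *m X]. *)
Lemma invA_upper : upper lvl lvl 0 (invmx Ahat)^T.
Proof.
apply: upper_fix shift_upper (_ : upper lvl lvl 0 1%:M) _.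
  move=> i j; rewrite mxE; case: (eqVneq i j) => [->|]; first by rewrite addn0.
  by rewrite eqxx.
have : (invmx Ahat *m Ahat)^T = 1%:M by rewrite mulVmx ?liftA_unit // trmx1.
rewrite trmx_mul /liftA -/D linearB /= trmx1 mulmxBl mul1mx => /eqP.
by rewrite subr_eq => /eqP.
Qed.

Lemma unshiftK : Dinv *m D = 1%:M - sel^T *m sel.
Proof.
rewrite mul_mxblock /sel_last tr_mxrow mul_mxcol_mxrow -mxdiagZ /mxdiag -mxblockB.
apply: eq_mxblock => i k; rewrite conform_mx_id.
have [ilt|ige] := ltnP i d; last first.
  have id : i = d :> nat by apply/eqP; rewrite eqn_leq ige -ltnS ltn_ord.
  rewrite big1 => [|j _]; last first.
    by rewrite id; case: eqP => [jd|_]; [have := ltn_ord j; rewrite jd ltnn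
                                        |rewrite mul0mx].
  have -> : (i == k) = (k == d :> nat) by rewrite -val_eqE /= id eq_sym.
  rewrite id eqxx trmx1; case: ifP => _; first by rewrite mul1mx subrr.
  by rewrite mulmx0 subr0.
have id1 : (i.+1 < d.+1)%N by [].
rewrite (bigD1 (Ordinal id1)) //= eqxx big1 => [|j]; last first.
  by rewrite -val_eqE /= => /negbTE ->; rewrite mul0mx.
rewrite (ltn_eqF ilt) trmx0 mul0mx subr0 addr0 eqSS -val_eqE /=.
by case: eqP => [->|_]; [rewrite mulVmx | rewrite mulmx0].
Qed.

Lemma unshift_inj : Dinv *m inj = 0.
Proof.
rewrite mul_mxblock_mxrow -mxcol0; apply: eq_mxcol => i.
rewrite big1 // => j _; case: eqP => [->|_]; last by rewrite mul0mx.
by rewrite mulmx0.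
Qed.

Lemma inj_gram : inj^T *m inj = 1%:M.
Proof.
rewrite tr_mxcol mul_mxrow_mxcol big_ord_recl /= trmx1 mul1mx.
by rewrite big1 ?addr0 // => i _; rewrite mulmx0.
Qed.

(** [Dinv] runs the dynamics backwards in time. It undoes [D] except on the last block, which is
    zero here. *)
Lemma unshift_liftA p (X : 'M[R]_(_, p)) : sel *m X = 0 ->
  Dinv *m (Ahat *m X) = Dinv *m X - X.
Proof.
move=> sX; rewrite /liftA -/D mulmxBl mul1mx mulmxBr; congr (_ - _).
by rewrite mulmxA unshiftK mulmxBl mul1mx -mulmxA sX mulmx0 subr0.
Qed.

(** A kernel vector starts an input-free trajectory ending at 0. Run backwards, this trajectory is a
    fixed point of the strictly triangular [Dinv], hence zero. *)
Lemma liftPhi_unit : Phi \in unitmx.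
Proof.
apply: unitmx_inj => x Px; pose v := invmx Ahat *m (inj *m x).
have sv : sel *m v = 0 by rewrite /v !mulmxA.
have Av : Ahat *m v = inj *m x by rewrite mulKVmx // liftA_unit.
have v0 : v = 0.
  apply: upper_fix0 unshift_upper _; apply/eqP; rewrite eq_sym -subr_eq0.
  by rewrite -unshift_liftA // Av mulmxA unshift_inj mul0mx.
by rewrite -[x]mul1mx -inj_gram -mulmxA -Av v0 !mulmx0.
Qed.

(* [T] maps inputs of the lifted dynamics to the trajectories that they produce
   when the initial state is chosen so that the final state is 0. Such a
   trajectory at step [i] depends only on the inputs from step [i] on, whereas
   the one started at 0 depends only on the inputs before step [i]. *)
Let T := invmx Ahat - invmx Ahat *m inj *m invmx Phi *m sel *m invmx Ahat.

Lemma terminal_map_upper : upper lvl lvl 1 T.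
Proof.
have sT : sel *m T = 0.
  rewrite /T mulmxBr !mulmxA -/Phi mulmxV ?liftPhi_unit // mul1mx.
  exact: subrr.
have AT : Ahat *m T = 1%:M - inj *m invmx Phi *m sel *m invmx Ahat.
  by rewrite /T mulmxBr !mulmxA mulmxV ?liftA_unit // mul1mx.
(* The fixed-point equation is [T = - Dinv + Dinv *m T]: the final state vanishes by [sT], and
   [Dinv] kills the injected initial state. *)
apply: upper_fix unshift_upper (upperN unshift_upper) _.
have := unshift_liftA sT; rewrite AT mulmxBr mulmx1 !mulmxA unshift_inj !mul0mx subr0.
by move=> e; rewrite {1}e opprB subrK.
Qed.

Lemma liftB_upper : upper lvl lvl_in 0 (liftB S d t)
  /\ upper lvl_in lvl 0 (liftB S d t)^T.
Proof.
by split=> i j /=; rewrite !mxE; case: ifP => [/eqP ->|]; rewrite ?addn0 // mxE eqxx.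
Qed.

Lemma liftC_upper : upper lvl_out lvl 0 (liftC S d t)
  /\ upper lvl lvl_out 0 (liftC S d t)^T.
Proof.
by split=> i j /=; rewrite !mxE; case: ifP => [/eqP ->|]; rewrite ?addn0 // mxE eqxx.
Qed.

Lemma liftDelta_upper :
  upper lvl_in lvl_in 1 (Delta^T *m (Delta - Xi *m invmx Phi *m Gamma)).
Proof.
have [uB uBT] := liftB_upper; have [uC uCT] := liftC_upper.
have -> : Delta - Xi *m invmx Phi *m Gamma = liftC S d t *m T *m liftB S d t.
  by rewrite /T mulmxBr mulmxBl !mulmxA.
apply: (@upperM _ _ _ _ _ lvl_out _ 0 1).
  rewrite /liftDelta !trmx_mul.
  exact: (upperM (a := 0) (b := 0) uBT (upperM (a := 0) (b := 0) invA_upper uCT)).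
exact: (upperM (a := 1) (b := 0) (upperM (a := 0) (b := 1) uC terminal_map_upper) uB).
Qed.

Local Notation Rdiag := (\mxdiag_(i < d) lqR S (d * t + i)).

Lemma Rdiag_pd : pd Rdiag.
Proof.
split=> [|x x0].
  by rewrite tr_mxdiag; apply: eq_mxdiag => i; case: (R_pd (d * t + i)).
have qE : qform Rdiag x = \sum_(i < d) qform (lqR S (d * t + i)) (submxcol x i).
  rewrite qformE -{1 2}[x]submxcolK mul_mxdiag_mxcol /dot tr_mxcol.
  by rewrite mul_mxrow_mxcol summxE; apply: eq_bigr => i _; rewrite qformE.
have p0 (i : 'I_d) : 0 <= qform (lqR S (d * t + i)) (submxcol x i).
  by have [_] := pd_psd (R_pd (d * t + i)); apply.
rewrite qE lt_def sumr_ge0 // andbT psumr_eq0 //; apply: contraNN x0 => /allP h.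
rewrite -[x]submxcolK; apply/eqP; rewrite -[RHS]mxcol0; apply: eq_mxcol => i.
apply/eqP; apply: contraTT (h i (mem_index_enum i)) => /= xi.
by rewrite gt_eqF //; case: (R_pd (d * t + i)) => _; apply.
Qed.

Lemma invmx_Rdiag : invmx Rdiag = \mxdiag_(i < d) invmx (lqR S (d * t + i)).
Proof.
have h : Rdiag *m (\mxdiag_(i < d) invmx (lqR S (d * t + i))) = 1%:M.
  rewrite mul_mxdiag_mxblock -mxdiagZ; apply: eq_mxblock => i j.
  case: eqP => [->|_]; last by rewrite mulmx0.
  by rewrite !conform_mx_id mulmxV // pd_unit.
by rewrite -[LHS]mulmx1 -h mulKmx //; exact: pd_unit Rdiag_pd.
Qed.

Lemma tildeR_pd : pd (tildeR S d t).
Proof. exact: pdDl Rdiag_pd (psd_gram _). Qed.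

(** [det_feedback] leaves [Rdiag] plus the matrix of [liftDelta_upper]. Multiplication by the
    block-diagonal [invmx Rdiag] preserves strict triangularity, so the correction does not change
    the determinant. *)
Lemma det_tildeA :
  \det (tildeR S d t) * \det (tildeA S d t) = \det Phi * \det Rdiag.
Proof.
rewrite det_feedback; [|exact: liftPhi_unit|exact: pd_unit tildeR_pd].
congr (_ * _).
have -> : tildeR S d t - Delta^T *m Xi *m invmx Phi *m Gamma
    = Rdiag + Delta^T *m (Delta - Xi *m invmx Phi *m Gamma).
  by rewrite /tildeR mulmxBr !mulmxA addrA.
set U := _ *m (_ - _).
have uD := pd_unit Rdiag_pd.
have -> : Rdiag + U = Rdiag *m (1%:M + invmx Rdiag *m U).
  by rewrite mulmxDr mulmx1 mulKVmx.
rewrite det_mulmx (@det_upper _ _ lvl_in) ?mulr1 // => [i j|].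
  by rewrite ltnS; exact: sig1_homo.
apply: (@upperM _ _ _ _ _ lvl_in _ 0 1); last exact: liftDelta_upper.
move=> i j /=; rewrite invmx_Rdiag !mxE; case: ifP => [/eqP ij _|_]; first by rewrite addn0 ij.
by rewrite mxE eqxx.
Qed.

Lemma det_tildeA_le : `|\det (tildeA S d t)| <= `|\det Phi|.
Proof.
have hR : 0 < `|\det (tildeR S d t)|.
  by rewrite normr_gt0 -unitfE -unitmxE; exact: pd_unit tildeR_pd.
rewrite -(ler_pM2l hR) -normrM det_tildeA normrM mulrC ler_wpM2r //.
exact: det_pd_gram Rdiag_pd.
Qed.

End Lifting.

(** * Boundedness of the lifted data *)

Section EntryBounds.
Variable R : realType.

(** Entrywise bounds pass directly through products, determinants and adjugates, which are
    polynomial in the entries. *)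
Definition entry_bounded m n (M : nat -> 'M[R]_(m, n)) :=
  exists c, forall t i j, `|M t i j| <= c.

Lemma entry_boundedW m n (M : nat -> 'M[R]_(m, n)) : entry_bounded M ->
  exists2 c, 0 <= c & forall t i j, `|M t i j| <= c.
Proof.
move=> [c hc]; exists `|c| => // t i j; apply: le_trans (hc t i j) _.
exact: ler_norm.
Qed.

Lemma entry_bounded_cst m n (M : 'M[R]_(m, n)) : entry_bounded (fun=> M).
Proof.
exists (\sum_i \sum_j `|M i j|) => _ i j.
rewrite (bigD1 i) //= (bigD1 j) //= -addrA lerDl addr_ge0 //.
  exact: sumr_ge0.
by apply: sumr_ge0 => k _; apply: sumr_ge0.
Qed.

Lemma entry_boundedD m n (M N : nat -> 'M[R]_(m, n)) :
  entry_bounded M -> entry_bounded N -> entry_bounded (fun t => M t + N t).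
Proof.
move=> [a ha] [b hb]; exists (a + b) => t i j; rewrite mxE.
by apply: le_trans (ler_normD _ _) _; rewrite lerD.
Qed.

Lemma entry_boundedN m n (M : nat -> 'M[R]_(m, n)) :
  entry_bounded M -> entry_bounded (fun t => - M t).
Proof. by move=> [a ha]; exists a => t i j; rewrite mxE normrN. Qed.

Lemma entry_boundedT m n (M : nat -> 'M[R]_(m, n)) :
  entry_bounded M -> entry_bounded (fun t => (M t)^T).
Proof. by move=> [a ha]; exists a => t i j; rewrite mxE. Qed.

Lemma entry_boundedM m n p (M : nat -> 'M[R]_(m, n)) (N : nat -> 'M[R]_(n, p)) :
  entry_bounded M -> entry_bounded N -> entry_bounded (fun t => M t *m N t).
Proof.
move=> /entry_boundedW[a a0 ha] /entry_boundedW[b b0 hb].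
exists (\sum_(k < n) a * b) => t i j; rewrite mxE.
apply: le_trans (ler_norm_sum _ _ _) _; apply: ler_sum => k _.
by rewrite normrM ler_pM.
Qed.

Lemma entry_boundedZ m n (M : nat -> 'M[R]_(m, n)) (a : nat -> R) c :
  (forall t, `|a t| <= c) -> entry_bounded M -> entry_bounded (fun t => a t *: M t).
Proof.
move=> ac [b hb]; exists (c * b) => t i j.
by rewrite mxE normrM ler_pM.
Qed.

Lemma det_entry_le n (M : 'M[R]_n) c : 0 <= c -> (forall i j, `|M i j| <= c) ->
  `|\det M| <= \sum_(s : 'S_n) c ^+ n.
Proof.
move=> c0 hc; apply: le_trans (ler_norm_sum _ _ _) _.
apply: ler_sum => s _; rewrite normrM normrX normrN1 expr1n mul1r normr_prod.
have -> : c ^+ n = \prod_(i < n) c by rewrite prodr_const card_ord.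
by apply: ler_prod => i _; rewrite normr_ge0 hc.
Qed.

Lemma entry_bounded_det n (M : nat -> 'M[R]_n) : entry_bounded M ->
  exists c, forall t, `|\det (M t)| <= c.
Proof.
move=> /entry_boundedW[c c0 hc]; exists (\sum_(s : 'S_n) c ^+ n) => t.
exact: det_entry_le.
Qed.

Lemma entry_bounded_adj n (M : nat -> 'M[R]_n) : entry_bounded M ->
  entry_bounded (fun t => \adj (M t)).
Proof.
move=> /entry_boundedW[c c0 hc]; exists (\sum_(s : 'S_n.-1) c ^+ n.-1) => t i j.
rewrite mxE /cofactor normrM normrX normrN1 expr1n mul1r.
by apply: det_entry_le => // k l; rewrite !mxE.
Qed.

Lemma entry_bounded_enorm m n (M : nat -> 'M[R]_(m, n)) : entry_bounded M ->
  exists2 c, 0 < c & forall t x, enorm (M t *m x) ^+ 2 <= c * enorm x ^+ 2.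
Proof.
move=> /entry_boundedW[c c0 hc]; exists (m%:R * (n%:R * c) ^+ 2 + 1).
  by rewrite ltr_wpDl // mulr_ge0 ?sqr_ge0.
move=> t x; apply: le_trans (enorm_mulmx_entry c0 (hc t) x) _.
by rewrite mulrDl lerDl mul1r sqr_ge0.
Qed.

Lemma enorm_entry_bounded m n (M : nat -> 'M[R]_(m, n)) c :
  (forall t x, enorm (M t *m x) ^+ 2 <= c ^+ 2 * enorm x ^+ 2) ->
  entry_bounded M.
Proof.
move=> h; exists `|c| => t i j.
have -> : M t i j = (M t *m delta_mx j ord0 : 'cV_m) i ord0.
  by rewrite -colE mxE.
apply: le_trans (entry_le_enorm _ _) _.
have := h t (delta_mx j ord0); rewrite -[c ^+ 2]real_normK ?num_real //.
rewrite enorm_le_sqr // => /le_trans; apply.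
rewrite -[leRHS]mulr1 ler_wpM2l //.
rewrite -(ler_pXn2r (_ : (0 < 2)%N)) ?nnegrE ?enorm_ge0 // -dotxx dotE.
rewrite (bigD1 j) //= big1 => [|k kj]; rewrite !mxE ?(negbTE kj) ?mul0r //.
by rewrite !eqxx addr0 mulr1 expr1n.
Qed.

Lemma unif_boundedP m n (M : nat -> 'M[R]_(m, n)) : unif_bounded M ->
  exists2 c : R, 0 <= c & forall t, norm2 (M t) <= c.
Proof.
move=> [c hc]; exists `|c| => // t; apply: le_trans (ler_norm _).
by apply: hc; exists t.
Qed.

Lemma unif_bounded_entry m n (M : nat -> 'M[R]_(m, n)) :
  unif_bounded M -> entry_bounded M.
Proof.
move=> /unif_boundedP[c c0 hc]; apply: (enorm_entry_bounded (c := c)) => t x.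
rewrite enorm_le_sqr //.
by apply: le_trans (enorm_mulmx _ _) _; rewrite ler_wpM2r ?enorm_ge0.
Qed.

Lemma entry_bounded_mxblock p q (p_ : 'I_p -> nat) (q_ : 'I_q -> nat)
    (B : nat -> forall i j, 'M[R]_(p_ i, q_ j)) c :
  (forall t i j k l, `|B t i j k l| <= c) ->
  entry_bounded (fun t => \mxblock_(i, j) B t i j).
Proof. by move=> h; exists c => t i j; rewrite mxE. Qed.

Lemma psd_sqrt_enorm n (M : 'M[R]_n) x :
  enorm (psd_sqrt M *m x) ^+ 2 <= norm2 M * enorm x ^+ 2.
Proof.
rewrite /psd_sqrt; case: xgetP => [N _ [[sN _] <-]|_].
  by rewrite -qform_gram sN qform_le_norm2.
by rewrite mul0mx enorm0 expr0n mulr_ge0 ?norm2_ge0 ?sqr_ge0.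
Qed.

(** The real [inf] is 0 by convention when no infimum exists, so its positivity already entails that
    the range is bounded below. *)
Lemma inf_range_le (f : nat -> R) : 0 < inf (range f) ->
  forall t, inf (range f) <= f t.
Proof.
move=> f0 t; apply: inf_lbound; last by exists t.
have : has_inf (range f).
  by apply: contrapT => /inf_out f0'; move: f0; rewrite f0' ltxx.
by case.
Qed.

End EntryBounds.

Section LiftedBounds.
Variables (R : realType) (n m d : nat) (S : lqdata R n m).
Hypotheses (A_bnd : unif_bounded (lqA S)) (B_bnd : unif_bounded (lqB S))
  (Q_bnd : unif_bounded (lqQ S)) (R_bnd : unif_bounded (lqR S))
  (A_unit : forall k, lqA S k \in unitmx) (R_pd : forall k, pd (lqR S k)).

Lemma lqC_bounded : entry_bounded (lqC S).
Proof.
have [c c0 hc] := unif_boundedP Q_bnd.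
apply: (enorm_entry_bounded (c := Num.sqrt c)) => t x.
rewrite (sqr_sqrtr c0); apply: le_trans (psd_sqrt_enorm _ _) _.
by rewrite ler_wpM2r ?sqr_ge0.
Qed.

Lemma liftA_bounded : entry_bounded (liftA S d).
Proof.
have [a a0 ha] := entry_boundedW (unif_bounded_entry A_bnd).
apply: entry_boundedD; first exact: entry_bounded_cst.
apply: entry_boundedN; apply: (entry_bounded_mxblock (c := a)) => t i j k l.
by case: ifP => _ //; rewrite mxE normr0.
Qed.

Lemma liftB_bounded : entry_bounded (liftB S d).
Proof.
have [a a0 ha] := entry_boundedW (unif_bounded_entry B_bnd).
apply: (entry_bounded_mxblock (c := a)) => t i j k l.
by case: ifP => _ //; rewrite mxE normr0.
Qed.

Lemma liftC_bounded : entry_bounded (liftC S d).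
Proof.
have [a a0 ha] := entry_boundedW lqC_bounded.
apply: (entry_bounded_mxblock (c := a)) => t i j k l.
by case: ifP => _ //; rewrite mxE normr0.
Qed.

(** The determinant of [liftA] is 1, so its inverse is its adjugate. *)
Lemma inv_liftA_bounded : entry_bounded (fun t => invmx (liftA S d t)).
Proof.
have [c hc] := entry_bounded_adj liftA_bounded; exists c => t i j.
by rewrite /invmx liftA_unit det_liftA invr1 scale1r.
Qed.

Lemma liftPhi_bounded : entry_bounded (liftPhi S d).
Proof.
by do !apply: entry_boundedM; first [exact: entry_bounded_cst
                                    | exact: inv_liftA_bounded].
Qed.

Lemma liftGamma_bounded : entry_bounded (liftGamma S d).
Proof.
do !apply: entry_boundedM; [exact: entry_bounded_cst
  | exact: inv_liftA_bounded | exact: liftB_bounded].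
Qed.

Lemma liftXi_bounded : entry_bounded (liftXi S d).
Proof.
do !apply: entry_boundedM; [exact: liftC_bounded
  | exact: inv_liftA_bounded | exact: entry_bounded_cst].
Qed.

Lemma liftDelta_bounded : entry_bounded (liftDelta S d).
Proof.
do !apply: entry_boundedM; [exact: liftC_bounded
  | exact: inv_liftA_bounded | exact: liftB_bounded].
Qed.

Lemma tildeR_bounded : entry_bounded (tildeR S d).
Proof.
have [a a0 ha] := entry_boundedW (unif_bounded_entry R_bnd).
apply: entry_boundedD; last first.
  by apply: entry_boundedM; [apply: entry_boundedT|]; exact: liftDelta_bounded.
apply: (entry_bounded_mxblock (c := a)) => t i j k l.
by case: ifP => _; rewrite ?conform_mx_id // mxE normr0.
Qed.

Lemma tildeQ_sym t : (tildeQ S d t)^T = tildeQ S d t.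
Proof.
have [sR _] := tildeR_pd d t R_pd.
rewrite /tildeQ; move: (liftXi S d t) (liftDelta S d t) (tildeR S d t) sR => X D G sG.
by rewrite linearB /= !trmx_mul !trmxK trmx_inv sG !mulmxA.
Qed.

Lemma tildeQ_le t x : qform (tildeQ S d t) x <= enorm (liftXi S d t *m x) ^+ 2.
Proof.
rewrite /tildeQ qformD qform_gram qformN gerBl.
have := psd_cong ((liftDelta S d t)^T *m liftXi S d t)
  (pd_psd (pd_inv (tildeR_pd d t R_pd))).
by rewrite trmx_mul trmxK !mulmxA => -[_]; apply.
Qed.

Variable a : R.
Hypotheses (a_gt0 : 0 < a)
  (A_ge : forall t x, a * enorm x ^+ 2 <= enorm ((tildeA S d t)^T *m x) ^+ 2).

Lemma tildeA_unit t : tildeA S d t \in unitmx.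
Proof.
rewrite -unitmx_tr; apply: unitmx_inj => x Ax; apply/eqP; rewrite -enorm_eq0.
have := A_ge t x; rewrite Ax enorm0 expr0n pmulr_rle0 // => h.
by rewrite -sqrf_eq0 eq_le h sqr_ge0.
Qed.

Lemma inv_tildeA_bounded : entry_bounded (fun t => invmx (tildeA S d t)).
Proof.
have : entry_bounded (fun t => invmx (tildeA S d t)^T).
  apply: (enorm_entry_bounded (c := (Num.sqrt a)^-1)) => t x.
  have := A_ge t (invmx (tildeA S d t)^T *m x).
  rewrite mulKVmx ?unitmx_tr ?tildeA_unit // exprVn (sqr_sqrtr (ltW a_gt0)).
  by rewrite ler_pdivlMl.
move=> /entry_boundedT[c hc]; exists c => t i j.
by have := hc t i j; rewrite trmx_inv trmxK.
Qed.

(* The lower bound on the singular values bounds the inverse, hence its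
   adjugate; the determinant is bounded by that of the open-loop map. *)
Lemma tildeA_bounded : entry_bounded (tildeA S d).
Proof.
have [c hc] := entry_bounded_det liftPhi_bounded.
have hd t : `|\det (tildeA S d t)| <= c.
  exact: le_trans (det_tildeA_le d t A_unit R_pd) (hc t).
have [b hb] := entry_boundedZ hd (entry_bounded_adj inv_tildeA_bounded).
exists b => t i j; have := hb t i j.
suff -> : tildeA S d t = \det (tildeA S d t) *: \adj (invmx (tildeA S d t)) by [].
rewrite -[LHS]invmxK {1}/invmx unitmx_inv tildeA_unit.
by rewrite det_inv invrK.
Qed.

End LiftedBounds.

(** * The constants and the performance bound *)

Section SupInfRange.
Variables (R : realType) (f : nat -> R).

Lemma sup_range_gt0 c : (forall t, f t <= c) -> (forall t, 0 < f t) ->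
  has_ubound (range f) /\ 0 < sup (range f).
Proof.
move=> fc f0; have ub : has_ubound (range f) by exists c => _ [t _ <-].
by split=> //; apply: lt_le_trans (f0 0%N) _; apply: ub_le_sup => //; exists 0%N.
Qed.

Lemma inf_range_gt0 c : 0 < c -> (forall t, c <= f t) ->
  has_lbound (range f) /\ 0 < inf (range f).
Proof.
move=> c0 fc; split; first by exists c => _ [t _ <-].
apply: lt_le_trans c0 _; apply: lb_le_inf; first by exists (f 0%N), 0%N.
by move=> _ [t _ <-].
Qed.

End SupInfRange.

(** The horizon condition solved for the contracted exponent. Multiplying by [ln g < 0] reverses the
    inequality, and the added 1 turns [T] into [T.-1]. *)
Lemma horizon_contraction (R : realType) (T : nat) (delta c g : R) :
  (0 < T)%N -> 0 < delta -> 0 < c -> 0 < g < 1 ->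
  ln (1 / delta * ln (c + 1)) / ln g + 1 <= T%:R ->
  g ^+ T.-1 * delta <= ln (1 + c).
Proof.
move=> T0 d0 c0 /andP[g0 g1]; have lg : ln g < 0 by rewrite ln_lt0 // g0 g1.
have lc : 0 < ln (c + 1) by rewrite ln_gt0 // ltrDr.
rewrite -[in X in _ <= X -> _](prednK T0) -natr1 lerD2r.
rewrite ler_ndivrMr // mulr_natl -lnXn // mul1r => h.
rewrite addrC mulrC -ler_pdivlMl // -ler_ln ?posrE ?exprn_gt0 //.
by rewrite mulr_gt0 // invr_gt0.
Qed.

Section FormBounds.
Variable R : realType.

Lemma qform_entry_bounded k (M : nat -> 'M[R]_k) : entry_bounded M ->
  exists2 c, 0 < c & forall t x, qform (M t) x <= c * enorm x ^+ 2.
Proof.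
move=> /entry_bounded_enorm[c c0 hc]; exists (Num.sqrt c); first by rewrite sqrtr_gt0.
move=> t x; rewrite qformE; apply: le_trans (ler_norm _) _.
apply: le_trans (cauchy_schwarz_enorm _ _) _; rewrite expr2 mulrCA.
rewrite ler_wpM2l ?enorm_ge0 // -enorm_le_sqr ?sqrtr_ge0 //.
by rewrite (sqr_sqrtr (ltW c0)).
Qed.

Lemma pd_1 k : pd (1%:M : 'M[R]_k).
Proof.
apply: (@pd_ge _ _ _ 1) => // [|x]; first by rewrite trmx1.
by rewrite qform_scalar.
Qed.

Lemma inv_le_of_ge k (M : 'M[R]_k) c p : pd M -> 0 < c ->
  (forall x, c * enorm x ^+ 2 <= qform M x) ->
  qform (invmx M) p <= c^-1 * enorm p ^+ 2.
Proof.
move=> pM c0 h; rewrite ler_pdivlMl //.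
rewrite -[enorm p ^+ 2]mul1r -qform_scalar -[X in _ <= qform X _]invmx1.
by apply: inv_le_scale => // [|x]; [exact: pd_1 | rewrite qform_scalar mul1r].
Qed.

Lemma inv_ge_of_le k (M : 'M[R]_k) c p : pd M -> 0 < c ->
  (forall x, qform M x <= c * enorm x ^+ 2) ->
  c^-1 * enorm p ^+ 2 <= qform (invmx M) p.
Proof.
move=> pM c0 h.
rewrite -[enorm p ^+ 2]mul1r -qform_scalar -{1}[1%:M]invmx1.
apply: inv_le_scale => // [||x]; [exact: pd_1 | by rewrite invr_gt0 |].
by rewrite qform_scalar mul1r ler_pdivrMl.
Qed.

End FormBounds.

Section Performance.
Variables (R : realType) (n m : nat) (S : lqdata R n m).
Variables (P : nat -> 'M[R]_n) (T : nat) (q b : R).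
Hypotheses (n_gt0 : (0 < n)%N) (T_gt0 : (0 < T)%N) (q_gt0 : 0 < q) (b_gt0 : 0 < b).
Hypotheses (Q_sym : forall t, (lqQ S t)^T = lqQ S t)
  (Q_ge : forall t x, q * enorm x ^+ 2 <= qform (lqQ S t) x)
  (Q_le : exists2 c, 0 < c & forall t x, qform (lqQ S t) x <= c * enorm x ^+ 2).
Hypotheses (R_pd : forall t, pd (lqR S t)) (R_bnd : entry_bounded (lqR S)).
Hypotheses (A_unit : forall t, lqA S t \in unitmx) (A_bnd : entry_bounded (lqA S))
  (iA_bnd : entry_bounded (fun t => invmx (lqA S t))).
Hypotheses (B_ge : forall t x, b * enorm x ^+ 2 <= enorm ((lqB S t)^T *m x) ^+ 2)
  (B_bnd : entry_bounded (lqB S)).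
Hypotheses (P_pd : forall t, pd (P t)) (P_bnd : unif_bounded P)
  (P_rec : forall t, P t = riccati S t (P t.+1)).

Local Notation W t := (riccati S t (Xhat S T t)).

Lemma lqQ_pd t : pd (lqQ S t).
Proof. exact: pd_ge q_gt0 (Q_ge t). Qed.

Lemma input_gram_ge t x :
  b * enorm x ^+ 2 <= qform (lqB S t *m (lqB S t)^T) x.
Proof. by have := B_ge t x; rewrite -qform_gram trmxK. Qed.

Lemma input_gram_pd t : pd (lqB S t *m (lqB S t)^T).
Proof. by apply: pd_ge b_gt0 (input_gram_ge t); rewrite trmx_mul trmxK. Qed.

Lemma input_gram_unit t : lqB S t *m (lqB S t)^T \in unitmx.
Proof. exact: pd_unit (input_gram_pd t). Qed.

Lemma Xterm_le :
  exists2 c, 0 < c & forall t x, qform (Xterm S t) x <= c * enorm x ^+ 2.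
Proof.
have [cQ cQ0 hQ] := Q_le; have [cR cR0 hR] := qform_entry_bounded R_bnd.
have [cA cA0 hA] := entry_bounded_enorm A_bnd.
exists (cQ + cR * (b^-1 * cA)) => [|t x].
  by rewrite addr_gt0 // !mulr_gt0 // invr_gt0.
rewrite qform_Xterm /stage_cost qformNx mulrDl lerD // -mulrA.
apply: le_trans (hR t _) _; rewrite ler_wpM2l ?(ltW cR0) //.
(* The dead-beat gain is the Moore-Penrose inverse of the input matrix applied to [lqA S t], so the
   energy of the input is an inverse Gram form, controlled by [b]. *)
have -> : enorm (deadbeat S t *m x) ^+ 2
    = qform (invmx (lqB S t *m (lqB S t)^T)) (lqA S t *m x).
  rewrite qform_inv ?input_gram_unit //; last by rewrite trmx_mul trmxK.
  by rewrite /deadbeat -!mulmxA -(qform_gram (lqB S t)^T) trmxK.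
apply: le_trans (inv_le_of_ge _ (input_gram_pd t) b_gt0 (input_gram_ge t)) _.
by rewrite -mulrA ler_wpM2l // invr_ge0 ltW.
Qed.

Lemma solution_ge t x : q * enorm x ^+ 2 <= qform (P t) x.
Proof.
apply: le_trans (Q_ge t x) _; rewrite P_rec; apply: riccati_geQ => //.
exact: pd_psd.
Qed.

Lemma rh_value_ge t x : q * enorm x ^+ 2 <= qform (W t) x.
Proof.
apply: le_trans (Q_ge t x) _; apply: riccati_geQ => //.
by apply/pd_psd/Xhat_pd => // ?; exact: lqQ_pd.
Qed.

Lemma rh_value_pd t : pd (W t).
Proof. by apply: riccati_Xhat_pd => // ?; exact: lqQ_pd. Qed.

Lemma rh_value_le_Xterm t x : qform (W t) x <= qform (Xterm S t) x.
Proof.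
apply: riccati_le_Xterm => //; first exact: input_gram_unit.
by apply/pd_psd/Xhat_pd => // ?; exact: lqQ_pd.
Qed.

(* Equality would make the dead-beat input optimal; it would then vanish, being
   followed by a zero state. *)
Lemma solution_lt_Xterm t x : x != 0 -> qform (P t) x < qform (Xterm S t) x.
Proof.
move=> x0; have pP := pd_psd (P_pd t.+1).
pose u := - (deadbeat S t *m x).
have Au0 : lqA S t *m x + lqB S t *m u = 0 := deadbeat_reaches0 input_gram_unit t x.
have XE : qform (Xterm S t) x = step_cost S t (P t.+1) x u.
  by rewrite /step_cost Au0 qform0x addr0 qform_Xterm.
have [pG0 pG] := hessian_pd (R_pd t) pP.
rewrite XE step_costE // -P_rec ltrDl; apply: pG; apply: contra_neq x0 => uK.
have uE : - (gain S t (P t.+1) *m x) = u by apply/eqP; rewrite eq_sym -addr_eq0 uK.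
have := gain_stationary (R_pd t) x pP; rewrite -mulmxN uE Au0 !mulmx0 => RK.
have K0 : gain S t (P t.+1) *m x = 0.
  by rewrite -[LHS](mulKmx (pd_unit (R_pd t))) RK mulmx0.
move: Au0; rewrite -uE K0 oppr0 mulmx0 addr0 => Ax.
by rewrite -[x](mulKmx (A_unit t)) Ax mulmx0.
Qed.

(** Strictness makes the logarithm in [delta_max] positive; it comes from [solution_lt_Xterm] at a
    unit vector. *)
Lemma delta_ratio_gt1 t : 1 < delta_ratio S P T t.
Proof.
have [x x1] := exists_unit_vector R n_gt0.
have sP : (P (t + T)%N)^T = P (t + T)%N by case: (P_pd (t + T)).
have l0 : 0 < lambda_min (P (t + T)%N).
  by apply: lt_le_trans q_gt0 (le_lambda_min n_gt0 sP (solution_ge _)).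
rewrite /delta_ratio ltr_pdivlMr // mul1r.
have := lambda_min_le x sP; have := qform_le_norm2 (Xterm S (t + T)) x.
rewrite x1 expr1n !mulr1 => h1 h2; apply: le_lt_trans h2 _.
by apply: lt_le_trans h1; apply: solution_lt_Xterm; rewrite -enorm_eq0 x1 oner_eq0.
Qed.

(** The matrix is [N *m invmx G *m N^T] with [G] bounded above. The upper bound on [lqA] enters as a
    lower bound on the transposed inverse inside [N^T], which is then combined with [b]. *)
Lemma eps_mx_ge :
  exists2 c, 0 < c & forall t p, c * enorm p ^+ 2 <= qform (eps_mx S t) p.
Proof.
have iAT t : (invmx (lqA S t))^T = invmx (lqA S t)^T by rewrite trmx_inv.
have N_bnd := entry_boundedM iA_bnd B_bnd.
have [cN cN0 hN] := entry_bounded_enorm N_bnd.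
have [cQ cQ0 hQ] := Q_le; have [cR cR0 hR] := qform_entry_bounded R_bnd.
have [cA cA0 hA] := entry_bounded_enorm (entry_boundedT A_bnd).
pose cG := cR + cQ * cN; have cG0 : 0 < cG by rewrite addr_gt0 ?mulr_gt0.
exists (cG^-1 * (b * cA^-1)) => [|t p]; first by rewrite !mulr_gt0 ?invr_gt0.
pose N := invmx (lqA S t) *m lqB S t.
pose G := lqR S t + N^T *m lqQ S t *m N.
have -> : eps_mx S t = N *m invmx G *m N^T.
  by rewrite /eps_mx /G /N trmx_mul iAT !mulmxA.
have pG : pd G by apply: pdDl => //; apply/psd_cong/pd_psd/lqQ_pd.
rewrite -{1}[N]trmxK qform_cong.
have hG u : qform G u <= cG * enorm u ^+ 2.
  rewrite qformD qform_cong mulrDl lerD //; apply: le_trans (hQ _ _) _.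
  by rewrite -mulrA ler_wpM2l ?(ltW cQ0) //; exact: hN.
apply: le_trans (inv_ge_of_le _ pG cG0 hG); rewrite -!mulrA ler_wpM2l ?invr_ge0 ?(ltW cG0) //.
have -> : N^T *m p = (lqB S t)^T *m (invmx (lqA S t)^T *m p).
  by rewrite /N trmx_mul iAT mulmxA.
apply: le_trans (B_ge _ _); rewrite ler_wpM2l ?(ltW b_gt0) // ler_pdivrMl //.
by have := hA t (invmx (lqA S t)^T *m p); rewrite mulKVmx ?unitmx_tr.
Qed.

Lemma eps_mx_sym t : (eps_mx S t)^T = eps_mx S t.
Proof.
have := psd_cong (invmx (lqA S t) *m lqB S t)^T
  (pd_psd (pd_inv (eps_hessian_pd (lqQ_pd t) (R_pd t)))).
by rewrite trmxK trmx_mul trmx_inv !mulmxA => -[].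
Qed.

Lemma zeta_mxE t :
  let N := (invmx (lqA S t) *m lqB S t)^T *m lqQ S t in
  zeta_mx S t = lqQ S t + N^T *m invmx (lqR S t) *m N.
Proof. by rewrite /zeta_mx /= !trmx_mul !trmxK Q_sym trmx_inv !mulmxA. Qed.

Lemma zeta_mx_ge t x : q * enorm x ^+ 2 <= qform (zeta_mx S t) x.
Proof.
rewrite zeta_mxE /= qformD; apply: le_trans (Q_ge t x) _; rewrite lerDl.
by case: (psd_cong ((invmx (lqA S t) *m lqB S t)^T *m lqQ S t)
  (pd_psd (pd_inv (R_pd t)))) => _; apply.
Qed.

Lemma zeta_mx_pd t : pd (zeta_mx S t).
Proof.
rewrite zeta_mxE; apply: pdDl; first exact: lqQ_pd.
exact/psd_cong/pd_psd/pd_inv.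
Qed.

Lemma constants_finite_positiveP : constants_finite_positive S P T.
Proof.
have [cX cX0 hX] := Xterm_le; have [cP cP0 hP] := unif_boundedP P_bnd.
have [cE cE0 hE] := eps_mx_ge.
split; split.
- apply: (sup_range_gt0 (c := cX)) => t; last exact: norm2_pd_gt0 (rh_value_pd t).
  apply: norm2_psd_le (ltW cX0) _ => [|x]; first exact/pd_psd/rh_value_pd.
  exact: le_trans (rh_value_le_Xterm t x) (hX t x).
- apply: inf_range_gt0 q_gt0 _ => t; apply: le_lambda_min (rh_value_ge t) => //.
  by case: (rh_value_pd t).
- apply: inf_range_gt0 q_gt0 _ => t; have pR := psd_cong (Kgain S T t) (pd_psd (R_pd t)).
  case: pR => sR pR; apply: le_lambda_min => [//||x].
    by rewrite linearD /= sR Q_sym.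
  by rewrite qformD; apply: le_trans (Q_ge t x) _; rewrite lerDl.
- apply: (sup_range_gt0 (c := cP)) => t //; exact: norm2_pd_gt0.
- have [ub _] : has_ubound (range (delta_ratio S P T)) /\
      0 < sup (range (delta_ratio S P T)).
    apply: (sup_range_gt0 (c := cX / q)) => t; last first.
      exact: lt_trans ltr01 (delta_ratio_gt1 t).
    have sP : (P (t + T)%N)^T = P (t + T)%N by case: (P_pd (t + T)).
    have l0 := le_lambda_min n_gt0 sP (solution_ge _).
    rewrite /delta_ratio ler_pM ?norm2_ge0 ?invr_ge0 ?(le_trans (ltW q_gt0)) //.
      apply: norm2_psd_le (ltW cX0) (hX _).
      by apply/pd_psd/Xterm_pd => // ?; exact: lqQ_pd.
    by rewrite lef_pV2 // posrE (lt_le_trans q_gt0).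
  split=> //; rewrite mulr_gt0 ?sqrtr_gt0 ?ltr0n // ln_gt0 //.
  apply: lt_le_trans (delta_ratio_gt1 0) _; exact: ub_le_sup.
- apply: (sup_range_gt0 (c := q^-1)) => t; last first.
    exact/norm2_pd_gt0/pd_inv/zeta_mx_pd.
  apply: norm2_psd_le => [||x]; [exact/pd_psd/pd_inv/zeta_mx_pd | by rewrite invr_ge0 ltW |].
  by apply: inv_le_of_ge q_gt0 (zeta_mx_ge t); exact: zeta_mx_pd.
- apply: inf_range_gt0 cE0 _ => t; apply: le_lambda_min (hE t) => //.
  exact: eps_mx_sym.
Qed.

Lemma perf_loss_of_bounds (bbar L o O H Z E s : R) xi :
  0 < bbar -> 0 < L -> 0 < o -> 0 < O -> 0 < H -> 0 < Z -> 0 < E ->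
  L <= O -> o <= O ->
  (forall x, qform (P 0%N) x <= H * enorm x ^+ 2) ->
  (forall t, delta_ratio S P T t <= s) ->
  (forall t p, qform (invmx (zeta_mx S t)) p <= Z * enorm p ^+ 2) ->
  (forall t p, E * enorm p ^+ 2 <= qform (eps_mx S t) p) ->
  ln (1 / (Num.sqrt n%:R * ln s) * ln (bbar * L * o / (O * H * O) + 1))
     / ln (Z / (Z + E)) + 1 <= T%:R ->
  (perf_loss S (rh_policy S T (Xterm S)) xi <= (bbar * enorm xi ^+ 2)%:E)%E.
Proof.
move=> bb0 L0 o0 O0 H0 Z0 E0 LO oO hPl s_ge hZ hE hT.
set c := _ / (O * H * O) in hT; set g := Z / _ in hT.
have c0 : 0 < c by rewrite divr_gt0 ?mulr_gt0.
have g01 : 0 < g < 1.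
  by rewrite divr_gt0 ?addr_gt0 //= /g ltr_pdivrMr ?addr_gt0 // mul1r ltrDl.
have s1 : 1 < s := lt_le_trans (delta_ratio_gt1 0) (s_ge 0%N).
have ls0 : 0 < ln s by rewrite ln_gt0.
have D0 : 0 < Num.sqrt n%:R * ln s by rewrite mulr_gt0 ?sqrtr_gt0 ?ltr0n.
have hg := horizon_contraction T_gt0 D0 c0 g01 hT.
have Xs x : qform (Xterm S (1 + T.-1)) x
    <= expR (ln s) * qform (P (1 + T.-1)%N) x.
  rewrite add1n prednK // lnK ?posrE ?(lt_trans ltr01) //.
  have sP : (P T)^T = P T by case: (P_pd T).
  have lP := lt_le_trans q_gt0 (le_lambda_min n_gt0 sP (solution_ge T)).
  apply: le_trans (qform_le_norm2 _ _) _.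
  apply: le_trans (_ : s * (lambda_min (P T) * enorm x ^+ 2) <= _); last first.
    by rewrite ler_wpM2l ?(ltW (lt_trans ltr01 s1)) // lambda_min_le.
  rewrite mulrA ler_wpM2r ?sqr_ge0 //.
  by have := s_ge 0%N; rewrite /delta_ratio add0n ler_pdivrMr.
have hX x : qform (Xhat S T 0) x <= (1 + c) * qform (P 1%N) x.
  have qP : 0 <= qform (P 1%N) x by have [_] := pd_psd (P_pd 1); apply.
  apply: le_trans (_ : expR (g ^+ T.-1 * ln s) * qform (P 1%N) x <= _).
    rewrite /Xhat add0n -{2}(prednK T_gt0) -add1n.
    apply: riccati_comp_contraction => //.
    - by move=> ?; exact: lqQ_pd.
    - by apply: Xterm_pd => // ?; exact: lqQ_pd.
    - exact: ltW.
  rewrite ler_wpM2r // -[leRHS]lnK ?posrE ?addr_gt0 // ler_expR.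
  (* [hg] controls the exponent with the factor [Num.sqrt n%:R], which is at least 1. *)
  apply: le_trans hg; rewrite ler_wpM2l ?exprn_ge0 ?(ltW (andP g01).1) //.
  by rewrite ler_peMl ?(ltW ls0) // -[leLHS]sqrtr1 ler_wsqrtr // ler1n.
have [cP cP0 hP] := unif_boundedP P_bnd.
have P_le t x : qform (P t) x <= cP * enorm x ^+ 2.
  by apply: le_trans (qform_le_norm2 _ _) _; rewrite ler_wpM2r ?sqr_ge0.
apply: le_trans (perf_loss_le lqQ_pd R_pd input_gram_unit T_gt0 P_pd P_rec q_gt0 cP0 P_le
  Q_ge xi (ltW c0) hX) _.
rewrite lee_fin; apply: le_trans (ler_wpM2l (ltW c0) (hPl xi)) _.
rewrite mulrA ler_wpM2r ?sqr_ge0 // /c.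
(* The bound [H] on [P] cancels, and [L * o / (O * O)] is at most 1 by [LO] and [oO]. *)
have -> : bbar * L * o / (O * H * O) * H = bbar * (L * o / (O * O)).
  by field; rewrite !gt_eqF.
rewrite ler_piMr ?(ltW bb0) // ler_pdivrMr ?mulr_gt0 // mul1r.
by rewrite ler_pM // ltW.
Qed.

Lemma lambda_min_le_omega_max t (M : 'M[R]_n) : M^T = M ->
  has_ubound (range (omega_max_seq S T)) ->
  (forall x, qform M x <= qform (W t) x) -> lambda_min M <= omega_max S T.
Proof.
move=> sM ub h; have [x x1] := exists_unit_vector R n_gt0.
have := lambda_min_le x sM; rewrite x1 expr1n mulr1 => /le_trans; apply.
apply: le_trans (h x) _; apply: le_trans (qform_le_norm2 _ _) _.
by rewrite x1 expr1n mulr1; apply: ub_le_sup => //; exists t.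
Qed.

(** [Kgain] is the optimal gain for [Xhat], so the left side is the stage-cost part of the value on
    the right. This yields the comparison of [lambda_lo] with [omega_max]. *)
Lemma closed_loop_weight_le t x :
  qform (lqQ S t + (Kgain S T t)^T *m lqR S t *m Kgain S T t) x
    <= qform (W t) x.
Proof.
have pX : psd (Xhat S T t) by apply/pd_psd/Xhat_pd => // ?; exact: lqQ_pd.
rewrite -(riccati_attained (R_pd t) x pX) /step_cost /stage_cost qformNx.
by rewrite qformD qform_cong lerDl; case: pX => _; exact.
Qed.

Lemma perf_loss_bound (bbar : R) xi : 0 < bbar ->
  ln (1 / delta_max S P T
       * ln (bbar * lambda_lo S T * omega_min S T
             / (omega_max S T * lambda_hi P * omega_max S T) + 1))
     / ln (zeta_max S / (zeta_max S + epsilon_min S)) + 1 <= T%:R ->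
  (perf_loss S (rh_policy S T (Xterm S)) xi <= (bbar * enorm xi ^+ 2)%:E)%E.
Proof.
move=> bb0.
have [[[ubO O0] [lbo o0] [lbl l0] [ubP P0]] [[ubD D0] [ubZ Z0] [lbE E0]]]
  := constants_finite_positiveP.
apply: (perf_loss_of_bounds xi bb0 l0 o0 O0 P0 Z0 E0).
- apply: le_trans (_ : lambda_min_seq S T 0 <= _).
    by apply: inf_lbound => //; exists 0%N.
  apply: (@lambda_min_le_omega_max 0) => // [|x]; last exact: closed_loop_weight_le.
  rewrite linearD /= Q_sym.
  by case: (psd_cong (Kgain S T 0) (pd_psd (R_pd 0))) => ->.
- apply: le_trans (_ : omega_min_seq S T 0 <= _).
    by apply: inf_lbound => //; exists 0%N.
  by apply: (@lambda_min_le_omega_max 0) => //; case: (rh_value_pd 0).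
- move=> x; apply: le_trans (qform_le_norm2 _ _) _.
  by rewrite ler_wpM2r ?sqr_ge0 //; apply: ub_le_sup => //; exists 0%N.
- by move=> t; apply: ub_le_sup => //; exists t.
- move=> t p; apply: le_trans (qform_le_norm2 _ _) _.
  by rewrite ler_wpM2r ?sqr_ge0 //; apply: ub_le_sup => //; exists t.
- move=> t p; apply: le_trans (lambda_min_le p (eps_mx_sym t)).
  by rewrite ler_wpM2r ?sqr_ge0 //; apply: inf_lbound => //; exists t.
Qed.

End Performance.

Lemma gram_inf_le (R : realType) p k (M : nat -> 'M[R]_(p, k)) t x :
  0 < inf (range (fun t => lambda_min (M t *m (M t)^T))) ->
  inf (range (fun t => lambda_min (M t *m (M t)^T))) * enorm x ^+ 2
    <= enorm ((M t)^T *m x) ^+ 2.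
Proof.
move=> /inf_range_le/(_ t) h; rewrite -qform_gram trmxK.
apply: le_trans (lambda_min_le x _); last by rewrite trmx_mul trmxK.
by rewrite ler_wpM2r ?sqr_ge0.
Qed.

Theorem corollary1 (R : realType) (n m d T : nat)
  (S : lqdata R n m) (P : nat -> 'M[R]_n) (bbar : R)
  (n_gt0 : (0 < n)%N) (m_gt0 : (0 < m)%N)
  (Q_psd : forall k, psd (lqQ S k))
  (R_pd : forall k, pd (lqR S k))
  (A_bnd : unif_bounded (lqA S)) (B_bnd : unif_bounded (lqB S))
  (Q_bnd : unif_bounded (lqQ S)) (R_bnd : unif_bounded (lqR S))
  (A_unit : forall k, lqA S k \in unitmx)
  (d_gt0 : (0 < d)%N)
  (ctrb_full : forall k, \rank (ctrb S k d) = n)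
  (obsv_full : forall k, \rank (obsv S k d) = n)
  (Qt_lo : 0 < inf (range (fun t => lambda_min (lqQ (lifted S d) t))))
  (Bt_lo : 0 < inf (range (fun t =>
     lambda_min (lqB (lifted S d) t *m (lqB (lifted S d) t)^T))))
  (At_lo : 0 < inf (range (fun t =>
     lambda_min (lqA (lifted S d) t *m (lqA (lifted S d) t)^T))))
  (P_pd : forall t, pd (P t)) (P_bnd : unif_bounded P)
  (P_rec : forall t, P t = riccati (lifted S d) t (P t.+1))
  (T_gt0 : (0 < T)%N) (bbar_gt0 : 0 < bbar) :
  let L := lifted S d in
  constants_finite_positive L P T /\
  (ln (1 / delta_max L P T
       * ln (bbar * lambda_lo L T * omega_min L T
             / (omega_max L T * lambda_hi P * omega_max L T) + 1))
     / ln (zeta_max L / (zeta_max L + epsilon_min L)) + 1 <= T%:R ->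
   forall xi : 'cV[R]_n,
     (perf_loss L (rh_policy L T (Xterm L)) xi
        <= (bbar * enorm xi ^+ 2)%:E)%E).
Proof.
move=> L.
have Q_sym t : (lqQ L t)^T = lqQ L t by exact: tildeQ_sym.
have Q_ge t x := le_trans
  (ler_wpM2r (sqr_ge0 (enorm x)) (inf_range_le Qt_lo t)) (lambda_min_le x (Q_sym t)).
have Q_le : exists2 c, 0 < c & forall t x, qform (lqQ L t) x <= c * enorm x ^+ 2.
  have [c c0 hc] := entry_bounded_enorm (liftXi_bounded d A_bnd Q_bnd).
  by exists c => // t x; apply: le_trans (tildeQ_le d R_pd t x) (hc t x).
have A_ge t x := gram_inf_le t x At_lo.
have B_ge t x := gram_inf_le t x Bt_lo.
have LR_pd t : pd (lqR L t) := tildeR_pd d t R_pd.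
have LR_bnd : entry_bounded (lqR L) := tildeR_bounded d A_bnd B_bnd Q_bnd R_bnd.
have LA_unit t : lqA L t \in unitmx := tildeA_unit At_lo A_ge t.
have LA_bnd : entry_bounded (lqA L) := tildeA_bounded A_bnd A_unit R_pd At_lo A_ge.
have LiA_bnd : entry_bounded (fun t => invmx (lqA L t)) := inv_tildeA_bounded At_lo A_ge.
have LB_bnd : entry_bounded (lqB L) := liftGamma_bounded d A_bnd B_bnd.
split; first exact: (constants_finite_positiveP T n_gt0 Qt_lo Bt_lo Q_sym Q_ge Q_le LR_pd LR_bnd
  LA_unit LA_bnd LiA_bnd B_ge LB_bnd P_pd P_bnd P_rec).
move=> hT xi.
exact: (perf_loss_bound n_gt0 T_gt0 Qt_lo Bt_lo Q_sym Q_ge Q_le LR_pd LR_bnd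
  LA_unit LA_bnd LiA_bnd B_ge LB_bnd P_pd P_bnd P_rec).
Qed.
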